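(* Let $\mathbf{k}$ be a countable discrete field of characteristic zero and let $G=\mathbf{k}\rtimes\mathbf{k}^*$. Then the $G$-invariant von Neumann subalgebras of $L(G)$ are exactly the following: $\mathbb{C}$; $L(\mathbf{k})^{F}$, where $F\subseteq\mathbf{k}^*$ is any finite subgroup; and $L(\mathbf{k}\rtimes H)$, where $H\subseteq\mathbf{k}^*$ is any subgroup.
   Context: $\mathbf{k}^*$ is the multiplicative group of non-zero elements of $\mathbf{k}$, acting on the additive group $\mathbf{k}$ by multiplication; $\mathbf{k}\rtimes\mathbf{k}^*$ is the corresponding semidirect product (a discrete group). $L(G)$ is the group von Neumann algebra of $G$, generated by canonical unitaries $v_g$ ($g\in G$). A (unital) von Neumann subalgebra $M\subseteq L(G)$ is $G$-invariant if $v_gMv_g^*=M$ for all $g\in G$. For a subgroup $N\subseteq G$, $L(N)=\{v_g:g\in N\}''\subseteq L(G)$. Write $u_q$ for the canonical unitary of $q\in\mathbf{k}$. For a finite subgroup $F\subseteq\mathbf{k}^*$, $L(\mathbf{k})^F=\{a\in L(\mathbf{k}): a=\sum_{q\in\mathbf{k}}c_qu_q,\ c_q=c_{qf}\ \forall q\in\mathbf{k},\ \forall f\in F\}$ is the fixed point von Neumann subalgebra of $L(\mathbf{k})$ under the $F$-action $u_q\mapsto u_{fq}$. *)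

(* Defs.v *)
From HB Require Import structures.
From mathcomp Require Import all_boot all_order all_algebra.
From mathcomp Require Import finmap complex ring.
From mathcomp Require Import all_classical all_reals all_analysis.
From mathcomp.analysis.showcase Require Import summability.

Set Implicit Arguments.
Unset Strict Implicit.
Unset Printing Implicit Defensive.

Import Order.TTheory GRing.Theory Num.Theory.
Import numFieldNormedType.Exports.
Import ComplexField.Normc.

Local Open Scope classical_set_scope.
Local Open Scope ring_scope.

Section SquareSummable.
Variables (R : realType) (G : choiceType).
Implicit Types f g : G -> R[i].

Definition sqnorm f (x : G) : \bar R := ((normc (f x)) ^+ 2)%:E.

Definition square_summable : {pred G -> R[i]} :=
  [pred f | `[< (\esum_(x in [set: G]) sqnorm f x < +oo)%E >]].

Lemma square_summableE f :
  (f \in square_summable) = (\esum_(x in [set: G]) sqnorm f x < +oo)%E.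
Proof. by rewrite inE /= asboolb. Qed.

Lemma square_summable_submod_closed : submod_closed square_summable.
Proof.
split.
  rewrite square_summableE esum1 ?ltry// => x _.
  by rewrite /sqnorm [normc _]normc0 expr0n.
move=> a f g; rewrite !square_summableE => ff gf.
pose c : R := 2 * (normc a) ^+ 2.
have c0 : 0 <= c by rewrite mulr_ge0 ?sqr_ge0.
apply: (@le_lt_trans _ _
  (\esum_(x in [set: G]) (c%:E * sqnorm f x + 2%:E * sqnorm g x))%E).
  apply: le_esum => x _; rewrite /sqnorm -!EFinM -EFinD lee_fin /c.
  set u := normc a; set v := normc (f x); set w := normc (g x).
  have n0 z : 0 <= normc z :> R by case: z => ? ?; exact: sqrtr_ge0.
  have h : normc ((a *: f + g) x) <= u * v + w.
    by rewrite /u /v -normcM; exact: le_normcD.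
  apply: (@le_trans _ _ ((u * v + w) ^+ 2)).
    by rewrite lerXn2r// nnegrE ?addr_ge0 ?mulr_ge0 ?n0.
  rewrite -subr_ge0.
  have -> : 2 * u ^+ 2 * v ^+ 2 + 2 * w ^+ 2 - (u * v + w) ^+ 2
            = (u * v - w) ^+ 2 by ring.
  exact: sqr_ge0.
have s0 h x : (0 <= sqnorm h x)%E by rewrite lee_fin sqr_ge0.
rewrite esumD; [|by move=> x _; rewrite mule_ge0..].
have scal (e : R) h : 0 <= e -> (\esum_(x in [set: G]) sqnorm h x < +oo)%E ->
    (\esum_(x in [set: G]) (e%:E * sqnorm h x) < +oo)%E.
  move=> e0 hf; apply: (@le_lt_trans _ _
    (e%:E * \esum_(x in [set: G]) sqnorm h x)%E); last first.
    by rewrite lte_mul_pinfty ?lee_fin.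
  apply: ub_ereal_sup => _ [A HA <-].
  rewrite -ge0_mule_fsumr//.
  apply: lee_pmul => //; first exact: fsume_ge0.
  by apply: ereal_sup_ubound; exists A.
by apply: lte_add_pinfty; exact: scal.
Qed.

Record l2 := L2 { l2_fun :> G -> R[i] ; _ : l2_fun \in square_summable }.

HB.instance Definition _ := [isSub for l2_fun].
HB.instance Definition _ := [Choice of l2 by <:].
HB.instance Definition _ := GRing.SubChoice_isSubLmodule.Build R[i]
  (G -> R[i]) square_summable l2 square_summable_submod_closed.

Definition l2norm (f : l2) : R :=
  Num.sqrt (fine (\esum_(x in [set: G]) sqnorm f x)).

(* The sum is the limit over the net of finite subsets of [G]. *)
Definition dot (f g : l2) : R[i] :=
  summability.sum (fun x => f x * (g x)^* : R[i]^o).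

End SquareSummable.

Lemma sum_reindex (R : realType) (G : choiceType) (e e' : G -> G)
    (F F' : G -> R[i]^o) :
  cancel e e' -> cancel e' e -> F \o e =1 F' ->
  summability.sum F = summability.sum F' :> R[i].
Proof.
have sub (h h' : G -> G) (u : G -> R[i]^o) : cancel h h' -> cancel h' h ->
    partial_sum u @ totally `<=` partial_sum (u \o h) @ totally.
  move=> hK h'K P [A _ AP]; exists [fset h' x | x in A]%fset => //= B AB.
  change (P (partial_sum (u \o h) B)).
  have -> : partial_sum (u \o h) B = partial_sum u [fset h x | x in B]%fset.
    transitivity (\sum_(x <- B) u (h x)); first by rewrite big_seq_fsetE.
    transitivity (\sum_(x <- [fset h x | x in B]%fset) u x).
      by rewrite big_imfset//= => x y _ _; exact: (can_inj hK).
    by rewrite big_seq_fsetE.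
  apply: AP => /=; apply/fsubsetP => x xA; apply/imfsetP; exists (h' x) => //=.
  by apply: (fsubsetP AB); apply/imfsetP; exists x.
move=> eK e'K /funext <-; rewrite /summability.sum.
suff -> : partial_sum F @ totally = partial_sum (F \o e) @ totally by [].
apply/seteqP; split; first exact: (sub e e').
have FE : F = (F \o e) \o e' by apply/funext => x /=; rewrite e'K.
by rewrite [X in _ `<=` partial_sum X @ _]FE; exact: (sub e' e).
Qed.

Section Operators.
Variables (R : realType) (G : groupType).
Local Notation H := (l2 R G).
Implicit Types (S T : H -> H) (M : set (H -> H)).

Definition bounded_operator T : Prop :=
  linear T /\ exists c : R, forall f, l2norm (T f) <= c * l2norm f.

Definition adjoint_of T S : Prop := forall f g, dot (T f) g = dot f (S g).

Definition commutant M : set (H -> H) :=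
  [set T | bounded_operator T /\ forall S, M S -> T \o S = S \o T].

(* A set of bounded operators that is stable under taking adjoints and equal
   to its bicommutant; such a set is a unital algebra since commutants are. *)
Definition von_neumann_algebra M : Prop :=
  [/\ M `<=` bounded_operator,
      forall T S, M T -> bounded_operator S -> adjoint_of T S -> M S
    & commutant (commutant M) = M].

Lemma lreg_subproof (g : G) (f : H) :
  (fun x => f (g^-1 * x)%g) \in @square_summable R G.
Proof.
have := valP f; rewrite !square_summableE.
rewrite [X in (X < _)%E -> _](@reindex_esum _ _ _ [set: G] _
  (fun x => g^-1 * x)%g)//.
split=> //.
- by move=> x y _ _; exact: mulgI.
- by move=> x _; exists (g * x)%g => //=; rewrite mulKg.
Qed.

(* The canonical unitary v_g, i.e. left translation by g. *)
Definition lreg (g : G) (f : H) : H := L2 (lreg_subproof g f).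

Definition group_vN (N : set G) : set (H -> H) :=
  commutant (commutant (@lreg @` N)).

Lemma delta_subproof (g : G) :
  (fun x => (x == g)%:R) \in @square_summable R G.
Proof.
rewrite square_summableE (_ : esum _ _ = 1%E) ?ltry//.
transitivity (\esum_(x in [set g]) (1%:E : \bar R))%E; last exact: esum_set1.
rewrite [RHS]esum_mkcond; apply: eq_esum => x _.
rewrite /sqnorm in_set1; case: eqP => _.
- by rewrite [normc _]normc1 expr1n.
- by rewrite [normc _]normc0 expr0n.
Qed.

Definition delta (g : G) : H := L2 (delta_subproof g).

(* For T in L(G), the coefficient of v_g in the Fourier expansion
   T = \sum_g c_g v_g, which converges in the 2-norm |T delta_1|. *)
Definition fourier_coef T (g : G) : R[i] := T (delta 1%g) g.

Definition von_neumann_subalgebra (A M : set (H -> H)) : Prop :=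
  von_neumann_algebra M /\ M `<=` A.

Lemma lreg_adjoint (g : G) : adjoint_of (lreg g) (lreg g^-1%g).
Proof.
move=> f h; apply: (sum_reindex (mulKg g) (mulVKg g)) => x.
by rewrite /= mulKg invgK.
Qed.

(* By lreg_adjoint, [lreg g^-1] is v_g^*. *)
Definition G_invariant M : Prop :=
  forall g, [set lreg g \o T \o lreg g^-1%g | T in M] = M.

Definition scalar_operators : set (H -> H) :=
  [set T | exists c : R[i], T = fun f => c *: f].

End Operators.

Section AffineGroup.
Variable k : fieldType.

Record kstar := KStar { kstar_val :> k ; kstar_neq0 : kstar_val != 0 }.

HB.instance Definition _ := [isSub for kstar_val].
HB.instance Definition _ := [Choice of kstar by <:].

Definition kstar_one := KStar (oner_neq0 k).
Definition kstar_mul (x y : kstar) : kstar :=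
  KStar (mulf_neq0 (kstar_neq0 x) (kstar_neq0 y)).
Definition kstar_inv (x : kstar) : kstar :=
  KStar (etrans (congr1 negb (invr_eq0 (x : k))) (kstar_neq0 x)).

Lemma kstar_mulA : associative kstar_mul.
Proof. by move=> x y z; apply: val_inj; exact: mulrA. Qed.
Lemma kstar_mul1 : left_id kstar_one kstar_mul.
Proof. by move=> x; apply: val_inj; exact: mul1r. Qed.
Lemma kstar_mulr1 : right_id kstar_one kstar_mul.
Proof. by move=> x; apply: val_inj; exact: mulr1. Qed.
Lemma kstar_mulV : left_inverse kstar_one kstar_inv kstar_mul.
Proof. by move=> x; apply: val_inj; exact: mulVf (kstar_neq0 x). Qed.
Lemma kstar_mulrV : right_inverse kstar_one kstar_inv kstar_mul.
Proof. by move=> x; apply: val_inj; exact: divff (kstar_neq0 x). Qed.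

HB.instance Definition _ := isGroup.Build kstar
  kstar_mulA kstar_mul1 kstar_mulr1 kstar_mulV kstar_mulrV.

(* The semidirect product of k by k^*; (a, b) is the map x |-> b x + a. *)
Definition affine : Type := k * kstar.

HB.instance Definition _ := Choice.on affine.

Definition affine_one : affine := (0, 1%g).
Definition affine_mul (x y : affine) : affine :=
  (x.1 + val x.2 * y.1, (x.2 * y.2)%g).
Definition affine_inv (x : affine) : affine :=
  (- (val (x.2^-1)%g * x.1), (x.2^-1)%g).

Lemma affine_mulA : associative affine_mul.
Proof.
move=> [a b] [c d] [e f]; congr pair => /=; last exact: mulgA.
by rewrite mulrDr addrA mulrA.
Qed.
Lemma affine_mul1 : left_id affine_one affine_mul.
Proof. by move=> [a b]; congr pair => /=; rewrite ?mul1g ?add0r ?mul1r. Qed.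
Lemma affine_mulr1 : right_id affine_one affine_mul.
Proof. by move=> [a b]; congr pair => /=; rewrite ?mulg1 ?mulr0 ?addr0. Qed.
Lemma affine_mulV : left_inverse affine_one affine_inv affine_mul.
Proof. by move=> [a b]; congr pair => /=; rewrite ?mulVg ?addNr. Qed.
Lemma affine_mulrV : right_inverse affine_one affine_inv affine_mul.
Proof.
move=> [a b]; congr pair => /=; last exact: mulgV.
by rewrite mulrN mulrA divff ?kstar_neq0// mul1r subrr.
Qed.

HB.instance Definition _ := isGroup.Build affine
  affine_mulA affine_mul1 affine_mulr1 affine_mulV affine_mulrV.

Definition translations : set affine := [set x | x.2 = 1%g].
Definition semidirect (U : set kstar) : set affine := [set x | U x.2].

Definition is_subgroup (U : set kstar) : Prop := group_closed [in U].

Variable R : realType.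

(* The fixed points in L(k) of u_q |-> u_(f q), for f in F, where u_q = v_(q, 1);
   L(k) sits inside L(affine) as the algebra generated by the translations. *)
Definition fixed_subalgebra (F : set kstar) : set (l2 R affine -> l2 R affine) :=
  [set a | group_vN translations a /\
    forall (q : k) (f : kstar), F f ->
      fourier_coef a (q, 1%g) = fourier_coef a (q * val f, 1%g)].

End AffineGroup.

(* Main.v *)
Require Import Defs.
From HB Require Import structures.
From mathcomp Require Import all_boot all_order all_algebra all_field cyclic.
From mathcomp Require Import finmap complex ring lra.
From mathcomp Require Import all_classical all_reals all_analysis.
From mathcomp.analysis.showcase Require Import summability.

(** Write E for the conditional expectation of L(G) onto an invariant subalgebra
    M, v_g for the canonical unitaries and delta_g for the basis of l2(G). The
    algebra M determines and is determined by the closed subspace L2(M) spanned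
    by M delta_1 (subalgP): the bicommutant theorem for subsets of L(G), in the
    form bicommutant_span, reduces membership in M to orthogonality. Hence E is
    replaced throughout by the orthogonal projection onto L2(M), and E(v_g) by
    the vector cexp g, the projection of delta_g. Closed spans are double
    orthogonal complements. Three facts survive on the level of vectors, with
    products read as convolutions: E(a v_g) = a E(v_g) for a in L2(M)
    (cexp_right), equivariance under conjugation (Ad_cexp), and the consequence
    that v_{g^-1} E(v_g) commutes with M (cexp_commute).

    Suppose first that E(v_b) is not zero for some b <> 1 in k^*, seen as the
    element (0, b) of G. The orbits of k^* by conjugation force
    E(v_b) = sum_c phi(c) v_c with c in k^*. Since v_{b^-1} E(v_b) commutes with
    the conjugate of E(v_b) by the translation 1, comparing coefficients gives
    phi(c) phi(y) = phi(z) phi(cy/z) with z = 1 - c(1-y)/b. With e = cy/b held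
    fixed this says that y |-> phi(be/y) phi(y) is invariant under the Moebius
    map y |-> 1 + e - e/y, whose multiplier is e. As phi is square summable the
    orbits in its support are finite, so e is a root of unity unless the orbit
    is a fixed point. Then the support of phi either is {b} or consists of roots
    of unity; in the latter case 1 + e = y' + e/y is a relation between roots of
    unity, which only has the trivial solutions (sum_roots_of_unity), and these
    again leave only b (braid_singleton). So v_b lies in M, its conjugates by
    translations put all translations into M, and M is L(k x| H), where H is the
    set of c with v_c in M (subalg_semidirect).

    Otherwise M lies in L(k). Equivariance gives E(u_q) = sum_c phi(c) u_(cq)
    with a single function phi on k. Comparing coefficients in
    E(E(u_p) u_q) = E(u_p) E(u_q), with p, q and the coefficient index moving to
    infinity along a suitable family, leaves one term on each side:
    phi(a) phi(b) = phi(a/b) phi(b) (translation_coef_mul). So phi is constant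
    on its support F, which is a finite subgroup of k^*. If F is empty then M is
    the scalars, otherwise E is the average over F and M is L(k)^F.

    Conversely the listed algebras are commutants of self-adjoint sets, and
    their coefficientwise descriptions are invariant under conjugation. *)

Set Implicit Arguments.
Unset Strict Implicit.
Unset Printing Implicit Defensive.

Import Order.TTheory GRing.Theory Num.Theory.
Import numFieldNormedType.Exports.
Import ComplexField.Normc.

Local Open Scope classical_set_scope.
Local Open Scope ring_scope.

(** * Unconditional sums of complex families *)

#[local] Existing Instance totally_filter.

Section HasSum.
Variables (R : realType) (G : choiceType).
Local Notation C := R[i].
Implicit Types (F : G -> C) (s : C).

Definition has_sum F s :=
  partial_sum (F : G -> C^o) @ totally --> (s : C^o).

Lemma partial_sumE (F : G -> C) (B : {fset G}) :
  partial_sum (F : G -> C^o) B = \sum_(x <- B) F x :> C.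
Proof. by rewrite big_seq_fsetE. Qed.

(** A positive element of R[i] is a real number, so real radii suffice. *)
Lemma has_sumP F s : has_sum F s <->
  forall e : R, 0 < e -> exists A : {fset G}, forall B : {fset G},
    (A `<=` B)%fset -> normc (s - \sum_(x <- B) F x) < e.
Proof.
rewrite /has_sum; split.
  move=> /cvgrPdist_lt h e e0.
  have e0' : (0 : C) < e%:C%C by rewrite ltcR.
  have [A _ HA] := h _ e0'.
  exists A => B AB.
  by have := HA B AB; rewrite /= partial_sumE ltcR.
move=> h; apply/cvgrPdist_lt => e; rewrite ltcE /= => /andP[/eqP ei e0].
have -> : e = (complex.Re e)%:C%C by case: e ei {e0} => a b /= ->.
have [A HA] := h _ e0; exists A => //= B AB.
by rewrite /= partial_sumE ltcR; exact: HA.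
Qed.

Lemma has_sum_unique F s t : has_sum F s -> has_sum F t -> s = t.
Proof. exact: (@cvg_unique C^o (@norm_hausdorff C C^o)). Qed.

Lemma has_sumE F s : has_sum F s ->
  summability.sum (F : G -> C^o) = s :> C.
Proof. by move=> h; apply: (@cvg_lim C^o (@norm_hausdorff C C^o)). Qed.

Lemma has_sumD F F' s s' : has_sum F s -> has_sum F' s' ->
  has_sum (fun x => F x + F' x) (s + s').
Proof.
move=> h h'; rewrite /has_sum.
rewrite (_ : partial_sum _ = partial_sum (F : G -> C^o) \+ partial_sum (F' : G -> C^o)).
  exact: cvgD h h'.
by apply/funext => A; rewrite /partial_sum /= big_split.
Qed.

Lemma has_sumZ F s (a : C) : has_sum F s -> has_sum (fun x => a * F x) (a * s).
Proof.
move=> h; rewrite /has_sum.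
rewrite (_ : partial_sum _ = fun A => (a *: partial_sum (F : G -> C^o) A : C^o)).
  by apply: cvgZr; exact: h.
by apply/funext => A; rewrite /partial_sum /= -mulr_sumr.
Qed.

Lemma normc_conj (z : C) : normc z^* = normc z.
Proof. by case: z => a b; rewrite /= sqrrN. Qed.

Lemma has_sumJ F s : has_sum F s -> has_sum (fun x => (F x)^*) s^*.
Proof.
move=> /has_sumP h; apply/has_sumP => e /h [A HA]; exists A => B /HA.
by rewrite -normc_conj rmorphB rmorph_sum.
Qed.

Lemma has_sum1 F x : (forall y, y != x -> F y = 0) -> has_sum F (F x).
Proof.
move=> h; apply/has_sumP => e e0; exists [fset x]%fset => B.
rewrite fsub1set => xB; rewrite (big_fsetD1 x)//= big_seq big1 ?addr0.
  by rewrite subrr normc0.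
by move=> y; rewrite !inE => /andP[yx _]; rewrite h.
Qed.

End HasSum.

Arguments has_sum_unique {R G F s t} _ _.
Arguments has_sumE {R G F s} _.
Arguments has_sumD {R G F F' s s'} _ _.
Arguments has_sumZ {R G F s} a _.
Arguments has_sumJ {R G F s} _.

(** * Square summable functions *)

Section SquareSums.
Variables (R : realType) (G : choiceType).
Local Notation C := R[i].
Local Notation H := (l2 R G).
Implicit Types (f g h : H).

Lemma l2normE f :
  (\esum_(x in [set: G]) sqnorm f x)%E = ((l2norm f) ^+ 2)%:E.
Proof.
have f0 : (0 <= \esum_(x in [set: G]) sqnorm f x)%E.
  by apply: esum_ge0 => x _; rewrite lee_fin sqr_ge0.
rewrite /l2norm sqr_sqrtr; last exact: fine_ge0.
rewrite fineK// ge0_fin_numE//.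
by have := valP f; rewrite square_summableE.
Qed.

Lemma l2norm_ge0 f : 0 <= l2norm f.
Proof. exact: sqrtr_ge0. Qed.

Lemma fsum_sqnorm (F : G -> C) (B : {fset G}) :
  (\sum_(x \in [set` B]) sqnorm F x)%E = (\sum_(x <- B) normc (F x) ^+ 2)%:E.
Proof. by rewrite fsbig_finite//= set_fsetK -sumEFin. Qed.

Lemma sum_le_l2norm f (B : {fset G}) :
  \sum_(x <- B) normc (f x) ^+ 2 <= l2norm f ^+ 2.
Proof.
rewrite -lee_fin -l2normE -fsum_sqnorm.
by apply: ereal_sup_ubound; exists [set` B].
Qed.

Lemma normc_le_l2norm f x : normc (f x) <= l2norm f.
Proof.
have := sum_le_l2norm f [fset x]%fset; rewrite big_seq_fset1.
have n0 : 0 <= normc (f x) by case: (f x) => ? ?; exact: sqrtr_ge0.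
by rewrite ler_sqr// nnegrE ?l2norm_ge0.
Qed.

Lemma l2norm_adherent f (e : R) : 0 < e -> exists A : {fset G},
  l2norm f ^+ 2 - e < \sum_(x <- A) normc (f x) ^+ 2.
Proof.
move=> e0; have fin : (\esum_(x in [set: G]) sqnorm f x)%E \is a fin_num.
  by rewrite l2normE.
have [_ [A [fA _] <-]] := ub_ereal_sup_adherent e0 fin.
rewrite -/(esum _ _) l2normE -EFinB -(fset_setK fA) fsum_sqnorm lte_fin => ?.
by exists (fset_set A).
Qed.

(** A bound on the finite sums yields the vector and its norm at once; all the
    vectors constructed from coordinates come from here. *)
Lemma square_summable_bound (F : G -> C) (c : R) :
  (forall B : {fset G}, \sum_(x <- B) normc (F x) ^+ 2 <= c) ->
  exists2 f : H, (f : G -> C) = F & l2norm f ^+ 2 <= c.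
Proof.
move=> h; have le : (\esum_(x in [set: G]) sqnorm F x <= c%:E)%E.
  apply: ge_ereal_sup => _ [A [fA _] <-].
  by rewrite -(fset_setK fA) fsum_sqnorm lee_fin.
have Fl : F \in @square_summable R G.
  by rewrite square_summableE (le_lt_trans le)// ltry.
exists (L2 Fl) => //; by rewrite -lee_fin -l2normE.
Qed.

Lemma normc_sqr (z : C) : (normc z ^+ 2)%:C%C = z * z^*.
Proof. by rewrite rmorphXn /= -[(normc z)%:C%C]/`|z| sqr_normc. Qed.

Lemma has_sum_sqnorm f : has_sum (fun x => f x * (f x)^*) (l2norm f ^+ 2)%:C%C.
Proof.
apply/has_sumP => e e0; have [A HA] := l2norm_adherent f e0.
exists A => B AB.
under eq_bigr do rewrite -normc_sqr.
rewrite -rmorph_sum -rmorphB /= expr0n /= addr0 sqrtr_sqr.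
have sB := sum_le_l2norm f B.
rewrite ger0_norm ?subr_ge0// ltrBlDr -ltrBlDl (lt_le_trans HA)//.
rewrite [leRHS](big_fsetID _ (mem A))/=.
rewrite (_ : [fset x | x in B & x \in A]%fset = A).
  by rewrite lerDl sumr_ge0// => x _; rewrite sqr_ge0.
apply/fsetP => x; rewrite !inE /= andbC; case: (boolP (x \in A)) => //= /(fsubsetP AB).
by [].
Qed.

Arguments has_sum_sqnorm f : clear implicits.

Lemma l2_addE f g x : (f + g) x = f x + g x. Proof. by []. Qed.
Lemma l2_scaleE (a : C) f x : (a *: f) x = a * f x. Proof. by []. Qed.
Lemma l2_oppE f x : (- f) x = - f x. Proof. by []. Qed.
Lemma l2_zeroE x : (0 : H) x = 0. Proof. by []. Qed.

Lemma l2P f g : (forall x, f x = g x) -> f = g.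
Proof. by move=> fg; apply: val_inj; apply/funext. Qed.

Lemma polarization_identity (a b : C) :
  a * b^* = 4%:R^-1 * (
    (a + b) * (a + b)^* + ((-1) * ((a - b) * (a - b)^*) +
    ('i * ((a + 'i * b) * (a + 'i * b)^*) +
    (- 'i) * ((a - 'i * b) * (a - 'i * b)^*)))).
Proof.
have n4 : 4%:R != 0 :> C by rewrite pnatr_eq0.
apply: (mulfI n4); rewrite mulVKf//.
rewrite !rmorphB !rmorphD !rmorphM /= conjCi.
have i2 : 'i * 'i = -1 :> C by rewrite -expr2 sqrCi.
move: ('i : C) i2 a^* b^* => j i2 a' b'.
transitivity (2 * (1 - j * j) * (a * b') + 2 * (1 + j * j) * (b * a') ).
  by rewrite i2; ring.
ring.
Qed.

(** By polarization the terms of a dot product are combinations of four squared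
    moduli, whose sums converge because they increase. *)
Lemma has_sum_dot f g : has_sum (fun x => f x * (g x)^*) (dot f g).
Proof.
have [s hs] : exists s, has_sum (fun x => f x * (g x)^*) s.
  have q1 := has_sum_sqnorm (f + g).
  have q2 := has_sumZ (- 1) (has_sum_sqnorm (f - g)).
  have q3 := has_sumZ 'i (has_sum_sqnorm (f + 'i *: g)).
  have q4 := has_sumZ (- 'i) (has_sum_sqnorm (f - 'i *: g)).
  have q := has_sumZ 4%:R^-1 (has_sumD q1 (has_sumD q2 (has_sumD q3 q4))).
  rewrite (_ : (fun x => f x * _) = fun x => 4%:R^-1 * ((f + g) x * ((f + g) x)^* +
    (-1 * ((f - g) x * ((f - g) x)^*) +
    ('i * ((f + 'i *: g) x * ((f + 'i *: g) x)^*) +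
    - 'i * ((f - 'i *: g) x * ((f - 'i *: g) x)^*))))).
    by eexists; exact: q.
  by apply/funext => x; exact: polarization_identity.
by rewrite /dot (has_sumE hs).
Qed.

End SquareSums.

Arguments has_sum_sqnorm {R G} f.
Arguments has_sum_dot {R G} f g.

(** * The inner product *)

Section DotTheory.
Variables (R : realType) (G : choiceType).
Local Notation C := R[i].
Local Notation H := (l2 R G).
Implicit Types (f g h : H) (a : C).

Lemma dotP f g s : has_sum (fun x => f x * (g x)^*) s -> dot f g = s.
Proof. exact: has_sum_unique (has_sum_dot f g). Qed.

Lemma eq_dot f g f' g' : (forall x, f x * (g x)^* = f' x * (g' x)^*) ->
  dot f g = dot f' g'.
Proof. by move=> /funext e; rewrite /dot e. Qed.

Lemma dotC f g : dot g f = (dot f g)^*.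
Proof.
apply: dotP; have := has_sumJ (has_sum_dot f g); congr has_sum.
by apply/funext => x; rewrite rmorphM /= conjCK mulrC.
Qed.

Lemma dotDl f g h : dot (f + g) h = dot f h + dot g h.
Proof.
apply: dotP; have := has_sumD (has_sum_dot f h) (has_sum_dot g h).
by congr has_sum; apply/funext => x; rewrite -mulrDl.
Qed.

Lemma dotZl a f h : dot (a *: f) h = a * dot f h.
Proof.
apply: dotP; have := has_sumZ a (has_sum_dot f h).
by congr has_sum; apply/funext => x; rewrite mulrA.
Qed.

Lemma dotDr f g h : dot h (f + g) = dot h f + dot h g.
Proof. by rewrite dotC dotDl rmorphD /= -!dotC. Qed.

Lemma dotZr a f h : dot h (a *: f) = a^* * dot h f.
Proof. by rewrite dotC dotZl rmorphM /= -dotC. Qed.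

Lemma dotNl f h : dot (- f) h = - dot f h.
Proof. by rewrite -scaleN1r dotZl mulN1r. Qed.

Lemma dotNr f h : dot h (- f) = - dot h f.
Proof. by rewrite dotC dotNl rmorphN /= -dotC. Qed.

Lemma dotBl f g h : dot (f - g) h = dot f h - dot g h.
Proof. by rewrite dotDl dotNl. Qed.

Lemma dotBr f g h : dot h (f - g) = dot h f - dot h g.
Proof. by rewrite dotDr dotNr. Qed.

Lemma dot0l h : dot 0 h = 0.
Proof. by rewrite -(subrr h) dotBl subrr. Qed.

Lemma dot0r h : dot h 0 = 0.
Proof. by rewrite -(subrr h) dotBr subrr. Qed.

Lemma dotxx f : dot f f = (l2norm f ^+ 2)%:C%C.
Proof. exact: dotP (has_sum_sqnorm f). Qed.

Lemma l2norm_eq0 f : l2norm f = 0 -> f = 0.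
Proof.
move=> f0; apply: l2P => x; rewrite l2_zeroE; apply/eq0_normc/eqP.
rewrite eq_le -{1}f0 normc_le_l2norm /=.
by case: (f x) => ? ?; exact: sqrtr_ge0.
Qed.

Lemma dotxx_eq0 f : dot f f = 0 -> f = 0.
Proof.
rewrite dotxx => /complexI /eqP; rewrite sqrf_eq0 => /eqP; exact: l2norm_eq0.
Qed.

Lemma normc_ge0 a : 0 <= normc a.
Proof. by case: a => ? ?; exact: sqrtr_ge0. Qed.

(** Expand the square norm of f - t g, for t = <f, g> / <g, g>. *)
Lemma cauchy_schwarz f g : normc (dot f g) <= l2norm f * l2norm g.
Proof.
have [/eqP /l2norm_eq0 ->|g0] := boolP (l2norm g == 0).
  by rewrite dot0r [normc _]normc0 mulr_ge0 ?l2norm_ge0.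
pose t : C := dot f g / dot g g.
have gC : dot g g != 0.
  by apply: contra g0 => /eqP; rewrite dotxx => /complexI/eqP; rewrite sqrf_eq0.
have E : dot (f - t *: g) (f - t *: g) = dot f f - dot f g * (dot f g)^* / dot g g.
  rewrite !dotBl !dotBr !dotZl !dotZr (dotC f g) /t rmorphM fmorphV /=.
  have -> : (dot g g)^* = dot g g by rewrite -dotC.
  by field.
move: E; rewrite !dotxx -normc_sqr -fmorphV -rmorphM -rmorphB /= => /complexI E.
have : 0 <= l2norm f ^+ 2 - normc (dot f g) ^+ 2 / l2norm g ^+ 2.
  by rewrite -E sqr_ge0.
rewrite subr_ge0 ler_pdivrMr ?exprn_gt0 ?lt_def ?g0 ?l2norm_ge0// -exprMn.
by rewrite ler_sqr// nnegrE ?mulr_ge0 ?normc_ge0 ?l2norm_ge0.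
Qed.

Lemma l2normD f g : l2norm (f + g) <= l2norm f + l2norm g.
Proof.
rewrite -ler_sqr ?nnegrE ?addr_ge0 ?l2norm_ge0//.
rewrite sqrrD.
have := dotxx (f + g); rewrite dotDl !dotDr !dotxx (dotC f g).
set d := dot f g => E.
have cs : complex.Re d <= l2norm f * l2norm g.
  apply: (le_trans _ (cauchy_schwarz f g)); rewrite -/d.
  case: (d) => u v /=; rewrite (le_trans (ler_norm u))// -sqrtr_sqr ler_wsqrtr//.
  by rewrite lerDl sqr_ge0.
have -> : l2norm (f + g) ^+ 2 = l2norm f ^+ 2 + complex.Re d *+ 2 + l2norm g ^+ 2.
  move: E; case: (d) => u v /eqP; rewrite eq_complex /= => /andP[/eqP E _].
  by rewrite -E mulr2n; ring.
by rewrite lerD2r lerD2l lerMn2r.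
Qed.

Lemma l2normN f : l2norm (- f) = l2norm f.
Proof.
apply/eqP; rewrite -(@eqrXn2 _ 2)// ?l2norm_ge0//; apply/eqP/complexI.
by rewrite -!dotxx dotNl dotNr opprK.
Qed.

Lemma l2normZ a f : l2norm (a *: f) = normc a * l2norm f.
Proof.
apply/eqP; rewrite -(@eqrXn2 _ 2)// ?mulr_ge0 ?normc_ge0 ?l2norm_ge0//.
apply/eqP/complexI.
by rewrite -dotxx dotZl dotZr dotxx mulrA -normc_sqr -rmorphM -exprMn.
Qed.

Lemma parallelogram f g : l2norm (f + g) ^+ 2 + l2norm (f - g) ^+ 2 =
  2 * l2norm f ^+ 2 + 2 * l2norm g ^+ 2.
Proof.
rewrite !mulr_natl !mulr2n; apply: complexI; rewrite !rmorphD /= -!dotxx.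
by rewrite !dotDl !dotDr !dotNl !dotNr; ring.
Qed.

End DotTheory.

(** * Completeness and orthogonal projections *)

Section Projection.
Variables (R : realType) (G : choiceType).
Local Notation C := R[i].
Local Notation H := (l2 R G).
Implicit Types (f g h : H) (a : C) (A : set H).

Lemma normc_sqrE (z : C) :
  normc z ^+ 2 = complex.Re z ^+ 2 + complex.Im z ^+ 2.
Proof. by case: z => u v /=; rewrite sqr_sqrtr// addr_ge0 ?sqr_ge0. Qed.

Lemma real_cauchy_cvg (u : nat -> R) :
  (forall e, 0 < e -> exists N, forall n, (N <= n)%N -> `|u N - u n| < e) ->
  cvg (u @ \oo).
Proof.
move=> h; apply: cauchy_cvg; apply: cauchy_exP => e /h [N HN].
by exists (u N); exists N.
Qed.

Lemma cvg_seq_sum (T : Type) (s : seq T) (F : T -> nat -> R) (l : T -> R) :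
  (forall x, F x @ \oo --> l x) ->
  (fun m => \sum_(x <- s) F x m) @ \oo --> \sum_(x <- s) l x.
Proof.
move=> h; elim: s => [|x s IH].
  rewrite big_nil (_ : (fun _ => _) = fun=> 0); first exact: cvg_cst.
  by apply/funext => m; rewrite big_nil.
rewrite big_cons (_ : (fun _ => _) = F x \+ (fun m => \sum_(x <- s) F x m)).
  exact: cvgD.
by apply/funext => m; rewrite big_cons.
Qed.

(** The coordinates converge. For a fixed finite set of coordinates the Cauchy
    bound on w n - w m passes to the limit in m, so w n - l is square summable
    with small norm. *)
Lemma l2_complete (w : nat -> H) :
  (forall e, 0 < e -> exists N, forall n m, (N <= n)%N -> (N <= m)%N ->
    l2norm (w n - w m) <= e) ->
  exists l, forall e, 0 < e -> exists N, forall n, (N <= n)%N ->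
    l2norm (w n - l) <= e.
Proof.
move=> cw.
have Re_le (z : C) : `|complex.Re z| <= normc z.
  rewrite -ler_sqr ?nnegrE ?normc_ge0// normc_sqrE real_normK ?num_real//.
  by rewrite lerDl sqr_ge0.
have Im_le (z : C) : `|complex.Im z| <= normc z.
  rewrite -ler_sqr ?nnegrE ?normc_ge0// normc_sqrE real_normK ?num_real//.
  by rewrite lerDr sqr_ge0.
have cv (p : C -> R) : {morph p : x y / x - y} -> (forall z, `|p z| <= normc z) ->
    forall x, cvg ((fun n => p (w n x)) @ \oo).
  move=> pB ple x; apply: real_cauchy_cvg => e e0.
  have [N HN] := cw (e / 2) (divr_gt0 e0 (ltr0Sn _ 1)).
  exists N => n Nn; rewrite -pB (le_lt_trans (ple _))//.
  apply: le_lt_trans (normc_le_l2norm (w N - w n) x) _.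
  by rewrite (le_lt_trans (HN _ _ _ _))// ltr_pdivrMr// ltr_pMr// ltr1n.
have cvR := cv _ (raddfB (@complex.Re R)) Re_le.
have cvI := cv _ (raddfB (@complex.Im R)) Im_le.
pose l x : C := Complex (lim ((fun n => complex.Re (w n x)) @ \oo))
  (lim ((fun n => complex.Im (w n x)) @ \oo)).
pose sq (z z' : C) : R := (complex.Re z - complex.Re z') ^+ 2 +
  (complex.Im z - complex.Im z') ^+ 2.
have key e : 0 < e -> exists N, forall n, (N <= n)%N ->
    forall B : {fset G}, \sum_(x <- B) normc (w n x - l x) ^+ 2 <= e ^+ 2.
  move=> e0; have [N HN] := cw e e0; exists N => n Nn B.
  pose u m : R := \sum_(x <- B) sq (w n x) (w m x).
  have cu : u @ \oo --> \sum_(x <- B) sq (w n x) (l x).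
    apply: cvg_seq_sum => x; apply: cvgD.
      by apply: cvgM; (apply: cvgB; [exact: cvg_cst|exact: cvR]).
    by apply: cvgM; (apply: cvgB; [exact: cvg_cst|exact: cvI]).
  rewrite (eq_bigr (fun x => sq (w n x) (l x))); last first.
    by move=> x _; rewrite normc_sqrE !raddfB.
  apply: cvgr_to_le cu _; exists N => // m /= Nm.
  apply: le_trans (_ : l2norm (w n - w m) ^+ 2 <= _); last first.
    by rewrite ler_sqr ?nnegrE ?l2norm_ge0 ?(ltW e0)// HN.
  apply: le_trans (sum_le_l2norm _ B); rewrite /u.
  rewrite (eq_bigr (fun x => normc ((w n - w m) x) ^+ 2))// => x _.
  by rewrite normc_sqrE !raddfB.
have [N HN] := key 1 ltr01.
have [d dE _] := square_summable_bound (HN _ (leqnn N)).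
exists (w N - d) => e e0; have [N' HN'] := key e e0; exists N' => n Nn.
have [d' d'E d'e] := square_summable_bound (HN' _ Nn).
rewrite (_ : w n - (w N - d) = d'); last first.
  by apply: l2P => x; rewrite !(l2_addE, l2_oppE) d'E dE; ring.
by rewrite -ler_sqr ?nnegrE ?l2norm_ge0 ?(ltW e0).
Qed.

(** The set perp (perp A) stands for the closed linear span of A. *)
Definition perp A : set H := [set h | forall f, A f -> dot f h = 0].

Lemma perp_sub A f g : perp A f -> perp A g -> perp A (f - g).
Proof. by move=> hf hg b Ab; rewrite dotBr hf ?hg ?subrr. Qed.

Lemma perp_add A f g : perp A f -> perp A g -> perp A (f + g).
Proof. by move=> hf hg b Ab; rewrite dotDr hf ?hg ?addr0. Qed.

Lemma perp_scale A a f : perp A f -> perp A (a *: f).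
Proof. by move=> hf b Ab; rewrite dotZr hf ?mulr0. Qed.

Lemma perp_closed A l :
  (forall e, 0 < e -> exists2 w, perp A w & l2norm (w - l) <= e) -> perp A l.
Proof.
move=> h b Ab; apply/eq0_normc/eqP; rewrite eq_le normc_ge0 andbT.
apply/ler_addgt0Pr => e e0; rewrite add0r.
have b1 : 0 < l2norm b + 1 by rewrite ltr_wpDl ?l2norm_ge0.
have [w Aw wl] := h (e / (l2norm b + 1)) (divr_gt0 e0 b1).
have -> : dot b l = - dot b (w - l) by rewrite dotBr Aw// sub0r opprK.
rewrite normcN (le_trans (cauchy_schwarz _ _))//.
apply: (@le_trans _ _ ((l2norm b + 1) * (e / (l2norm b + 1)))).
  by rewrite ler_pM ?l2norm_ge0// lerDl.
by rewrite mulrC divfK// gt_eqF.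
Qed.

(** Otherwise moving f along a small multiple of <f, h> h would shorten it. *)
Lemma min_dist_perp f h : (forall t : C, l2norm f <= l2norm (f - t *: h)) ->
  dot f h = 0.
Proof.
move=> hmin; apply/eqP/negP => /negP c0; set c := dot f h in c0.
(* Any step shorter than 2 / |h|^2 would do; the 1 covers h = 0. *)
pose k := (l2norm h ^+ 2 + 1)^-1.
have k0 : 0 < k by rewrite invr_gt0 ltr_wpDl ?sqr_ge0.
pose t : C := k%:C%C * c.
have : l2norm f ^+ 2 <= l2norm (f - t *: h) ^+ 2 by rewrite ler_sqr ?nnegrE ?l2norm_ge0.
have -> : l2norm (f - t *: h) ^+ 2 = l2norm f ^+ 2 - k * normc c ^+ 2
    - k * normc c ^+ 2 + k * k * normc c ^+ 2 * l2norm h ^+ 2.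
  apply: complexI; rewrite -dotxx !dotBl !dotBr !dotZl !dotZr (dotC f h) -/c.
  have := normc_sqr c; have := dotxx f; have := dotxx h => -> ->.
  move: (l2norm h ^+ 2) (l2norm f ^+ 2) (normc c ^+ 2) => nh nf q qE.
  rewrite !(rmorphB, rmorphD, rmorphM) /= qE.
  have -> : (k%:C%C)^* = k%:C%C by exact: conjc_real.
  by rewrite /t; ring.
have q0 : 0 < normc c ^+ 2.
  by rewrite exprn_gt0// lt_def normc_ge0 andbT; apply: contra c0 => /eqP/eq0_normc ->.
have kh : k * l2norm h ^+ 2 = 1 - k.
  have : k * (l2norm h ^+ 2 + 1) = 1 by rewrite mulVf// gt_eqF// ltr_wpDl ?sqr_ge0.
  by move=> <-; ring.
have -> : k * k * normc c ^+ 2 * l2norm h ^+ 2 = k * normc c ^+ 2 * (1 - k).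
  by rewrite -kh; ring.
have kq0 : 0 < k * normc c ^+ 2 by exact: mulr_gt0.
have := mulr_gt0 kq0 k0.
lra.
Qed.

(** A sequence in perp A that minimizes the distance to f is Cauchy by the
    parallelogram law; f minus its limit is the component in the span of A. *)
Theorem orthogonal_projection A f :
  exists2 p, perp (perp A) p & perp A (f - p).
Proof.
pose D := [set l2norm (f - w) ^+ 2 | w in perp A].
have D0 : D !=set0 by exists (l2norm (f - 0) ^+ 2), 0 => // b _; rewrite dot0r.
have hD : has_inf D by split=> //; exists 0 => _ [w _ <-]; exact: sqr_ge0.
pose d := inf D.
have dle w : perp A w -> d <= l2norm (f - w) ^+ 2.
  by move=> Aw; apply: ge_inf; [case: hD|exists w].
have d0 : 0 <= d by apply: lb_le_inf => // _ [w _ <-]; exact: sqr_ge0.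
have /choice [w Hw] : forall n, exists w,
    perp A w /\ l2norm (f - w) ^+ 2 < d + n.+1%:R^-1.
  move=> n; have n0 : 0 < n.+1%:R^-1 :> R by rewrite invr_gt0 ltr0n.
  by have [_ [w Aw <-] wd] := inf_adherent n0 hD; exists w.
have small e : 0 < e -> exists N, forall n, (N <= n)%N -> n.+1%:R^-1 <= e :> R.
  move=> e0; have [N HN] := ltr_add_invr e0; exists N => n Nn.
  rewrite add0r in HN; rewrite (le_trans _ (ltW HN))//.
  by rewrite lef_pV2 ?posrE ?ltr0n// ler_nat.
have [|l Hl] := @l2_complete w.
  move=> e e0; have e4 : 0 < e ^+ 2 / 4 by rewrite divr_gt0 ?exprn_gt0.
  have [N HN] := small _ e4; exists N => n m /HN Nn /HN Nm.
  rewrite -ler_sqr ?nnegrE ?l2norm_ge0 ?(ltW e0)//.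
  have [[An dn] [Am dm]] := (Hw n, Hw m).
  have := parallelogram (f - w n) (f - w m).
  have -> : f - w n - (f - w m) = - (w n - w m).
    by apply: l2P => x; rewrite !(l2_addE, l2_oppE); ring.
  rewrite l2normN.
  have -> : f - w n + (f - w m) = 2%:R *: (f - 2%:R^-1 *: (w n + w m)).
    apply: l2P => x; rewrite !(l2_addE, l2_oppE, l2_scaleE) mulrBr mulVKf ?pnatr_eq0//.
    ring.
  rewrite l2normZ exprMn.
  have -> : normc (2%:R : C) ^+ 2 = 4.
    by apply: complexI; rewrite normc_sqr conjC_nat; rewrite -natrM rmorph_nat.
  have arith (u v un um e' : R) : 4 * u + v = 2 * un + 2 * um -> d <= u ->
    un <= d + e' / 4 -> um <= d + e' / 4 -> v <= e' by lra.
  move=> par; apply: (arith _ _ _ _ _ par).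
  - exact: dle (perp_scale 2%:R^-1 (perp_add An Am)).
  - exact: le_trans (ltW dn) (lerD (lexx d) Nn).
  - exact: le_trans (ltW dm) (lerD (lexx d) Nm).
exists (f - l); last first.
  have -> : f - (f - l) = l by rewrite opprD opprK addrA subrr add0r.
  apply: perp_closed => e /Hl [N HN]; exists (w N); first by have [] := Hw N.
  exact: HN.
have Al : perp A l.
  apply: perp_closed => e /Hl [N HN]; exists (w N); first by have [] := Hw N.
  exact: HN.
have fl : l2norm (f - l) ^+ 2 <= d.
  have sd : 0 <= Num.sqrt d by exact: sqrtr_ge0.
  suff h : l2norm (f - l) <= Num.sqrt d.
    by rewrite -(sqr_sqrtr d0) ler_sqr// nnegrE ?l2norm_ge0.
  apply/ler_addgt0Pr => e e0; have e2 : 0 < e / 2 by rewrite divr_gt0.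
  have [N1 HN1] := Hl _ e2.
  have [N2 HN2] := small _ (exprn_gt0 2 e2).
  have := HN1 _ (leq_maxl N1 N2); have := HN2 _ (leq_maxr N1 N2).
  set n := maxn N1 N2 => n2 n1; have [An dn] := Hw n.
  have -> : f - l = (f - w n) + (w n - l) by rewrite addrA subrK.
  rewrite (le_trans (l2normD _ _))// (_ : e = e / 2 + e / 2); last by field.
  rewrite addrA lerD// -ler_sqr ?nnegrE ?l2norm_ge0 ?addr_ge0 ?(ltW e2)//.
  rewrite (le_trans (ltW dn))// sqrrD (sqr_sqrtr d0) -addrA lerD2l.
  by rewrite (le_trans n2)// lerDr mulrn_wge0// mulr_ge0// ltW.
move=> h Ah; rewrite dotC; apply/eqP; rewrite conjC_eq0; apply/eqP.
apply: min_dist_perp => t; rewrite -ler_sqr ?nnegrE ?l2norm_ge0//.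
apply: (le_trans fl); rewrite -addrA -opprD; apply: dle.
by apply: perp_add => //; exact: perp_scale.
Qed.

End Projection.

(** * Finitely supported vectors, adjoints and weak convergence *)

Section Delta.
Variables (R : realType) (G : groupType).
Local Notation C := R[i].
Local Notation H := (l2 R G).
Implicit Types (f g h : H) (a : C) (S T : H -> H) (x y : G).

Lemma deltaE x y : delta R x y = (y == x)%:R :> C. Proof. by []. Qed.

Lemma dot_delta f x : dot f (delta R x) = f x.
Proof.
apply: dotP; have -> : f x = f x * (delta R x x)^* by rewrite deltaE eqxx rmorph1 mulr1.
apply: (@has_sum1 R G (fun y => f y * (delta R x y)^*)) => y /negPf yx.
by rewrite deltaE yx rmorph0 mulr0.
Qed.

Lemma delta_dot f x : dot (delta R x) f = (f x)^*.
Proof. by rewrite dotC dot_delta. Qed.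

Definition trunc (B : {fset G}) f : H := \sum_(x <- B) f x *: delta R x.

Lemma dot_suml (I : Type) (s : seq I) (F : I -> H) h :
  dot (\sum_(i <- s) F i) h = \sum_(i <- s) dot (F i) h.
Proof. by apply: (big_morph (fun f => dot f h)) => [f g|]; rewrite (dotDl, dot0l). Qed.

Lemma dot_trunc B f g : dot (trunc B f) g = \sum_(x <- B) f x * (g x)^*.
Proof. by rewrite dot_suml; apply: eq_bigr => x _; rewrite dotZl delta_dot. Qed.

Lemma truncE B f x : x \in B -> trunc B f x = f x.
Proof.
move=> xB; rewrite -dot_delta dot_trunc (big_fsetD1 x)//= big_seq big1.
  by rewrite ?deltaE eqxx rmorph1 mulr1 addr0.
by move=> y; rewrite !inE ?deltaE => /andP[/negPf -> _]; rewrite rmorph0 mulr0.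
Qed.

Lemma l2norm_sub_trunc B f :
  l2norm (f - trunc B f) ^+ 2 = l2norm f ^+ 2 - \sum_(x <- B) normc (f x) ^+ 2.
Proof.
apply: complexI; rewrite rmorphB rmorph_sum /= -!dotxx.
under eq_bigr do rewrite normc_sqr.
suff d0 : dot (f - trunc B f) (trunc B f) = 0.
  by rewrite -dot_trunc [LHS]dotBr d0 subr0 dotBl.
rewrite dotC dot_trunc big_seq big1 ?rmorph0// => x xB.
by rewrite !(l2_addE, l2_oppE) truncE// subrr rmorph0 mulr0.
Qed.

Lemma trunc_dense f (e : R) : 0 < e -> exists A : {fset G}, forall B : {fset G},
  (A `<=` B)%fset -> l2norm (f - trunc B f) < e.
Proof.
move=> e0; have [A HA] := l2norm_adherent f (exprn_gt0 2 e0).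
exists A => B AB; rewrite -ltr_sqr ?nnegrE ?l2norm_ge0 ?(ltW e0)//.
rewrite l2norm_sub_trunc ltrBlDr -ltrBlDl (lt_le_trans HA)//.
rewrite [leRHS](big_fsetID _ (mem A))/=.
rewrite (_ : [fset x | x in B & x \in A]%fset = A).
  by rewrite lerDl sumr_ge0// => x _; rewrite sqr_ge0.
apply/fsetP => x; rewrite !inE /= andbC; case: (boolP (x \in A)) => //= /(fsubsetP AB).
by [].
Qed.

(** The finite sums are the values of L at the truncations of f, which converge
    to f in norm. *)
Lemma has_sum_functional (L : H -> C) (c : R) f :
  (forall a g h, L (a *: g + h) = a * L g + L h) ->
  (forall g, normc (L g) <= c * l2norm g) ->
  has_sum (fun x => f x * L (delta R x)) (L f).
Proof.
move=> Llin Lb; apply/has_sumP => e e0.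
have c1 : 0 < `|c| + 1 by rewrite ltr_wpDl.
have [A HA] := trunc_dense f (divr_gt0 e0 c1); exists A => B /HA hB.
have LD g h : L (g + h) = L g + L h by have := Llin 1 g h; rewrite scale1r mul1r.
have L0 : L 0 = 0 by apply: (addrI (L 0)); rewrite -LD !addr0.
have LZ b g : L (b *: g) = b * L g by have := Llin b g 0; rewrite !addr0 L0 addr0.
have LB g h : L (g - h) = L g - L h by rewrite LD -scaleN1r LZ mulN1r.
have -> : \sum_(x <- B) f x * L (delta R x) = L (trunc B f).
  by rewrite (big_morph L LD L0); apply: eq_bigr => x _; rewrite LZ.
rewrite -LB (le_lt_trans (Lb _))//.
apply: (@le_lt_trans _ _ ((`|c| + 1) * l2norm (f - trunc B f))).
  by rewrite ler_wpM2r ?l2norm_ge0// (le_trans (ler_norm c))// lerDl.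
by rewrite mulrC -ltr_pdivlMr.
Qed.

Section Bounded.
Variable T : H -> H.
Hypothesis bT : bounded_operator T.

Lemma bopD f g : T (f + g) = T f + T g.
Proof. by have [lT _] := bT; have := lT 1 f g; rewrite !scale1r. Qed.

Lemma bop0 : T 0 = 0.
Proof. by apply: (addrI (T 0)); rewrite -bopD !addr0. Qed.

Lemma bopZ a f : T (a *: f) = a *: T f.
Proof. by have [lT _] := bT; have := lT a f 0; rewrite bop0 !addr0. Qed.

Lemma bopB f g : T (f - g) = T f - T g.
Proof. by rewrite bopD -scaleN1r bopZ scaleN1r. Qed.

Lemma bop_bound : exists2 c : R, 0 <= c & forall f, l2norm (T f) <= c * l2norm f.
Proof.
have [_ [c hc]] := bT; exists `|c| => // f.
by rewrite (le_trans (hc f))// ler_wpM2r ?l2norm_ge0// ler_norm.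
Qed.

(** The coordinates of S g have to be <g, T delta_x>. Their square sum over a
    finite set B is <g, T h>, for h the vector with these coordinates on B,
    hence at most c |g| |h|, which bounds |h|. *)
Lemma adjoint_exists : exists2 S, bounded_operator S & adjoint_of T S.
Proof.
have [c c0 Tc] := bop_bound.
have bound g (B : {fset G}) :
    \sum_(x <- B) normc (dot g (T (delta R x))) ^+ 2 <= (c * l2norm g) ^+ 2.
  pose h : H := \sum_(x <- B) dot g (T (delta R x)) *: delta R x.
  have Th : T h = \sum_(x <- B) dot g (T (delta R x)) *: T (delta R x).
    by rewrite /h (big_morph T bopD bop0); apply: eq_bigr => x _; rewrite bopZ.
  have hx x : x \in B -> h x = dot g (T (delta R x)).
    move=> xB; rewrite -dot_delta dot_suml (big_fsetD1 x)//= big_seq big1.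
      by rewrite dotZl dot_delta ?deltaE eqxx mulr1 addr0.
    move=> y; rewrite !inE => /andP[yx _].
    by rewrite dotZl dot_delta ?deltaE eq_sym (negPf yx) mulr0.
  set s := \sum_(x <- B) _.
  have gTh : dot (T h) g = s%:C%C.
    rewrite Th dot_suml rmorph_sum /=; apply: eq_bigr => x _.
    by rewrite normc_sqr dotZl -dotC.
  have hh : l2norm h ^+ 2 = s.
    apply: complexI; rewrite -dotxx {1}/h dot_suml rmorph_sum /=.
    apply: eq_big_seq => x xB.
    by rewrite dotZl delta_dot hx// normc_sqr.
  have s0 : 0 <= s by rewrite -hh sqr_ge0.
  have sle : s <= c * l2norm h * l2norm g.
    apply: (@le_trans _ _ (normc (dot (T h) g))).
      by rewrite gTh /= expr0n /= addr0 sqrtr_sqr ger0_norm.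
    by rewrite (le_trans (cauchy_schwarz _ _))// ler_wpM2r ?l2norm_ge0.
  have [h0|h0] := eqVneq (l2norm h) 0.
    by rewrite -hh h0 expr0n sqr_ge0.
  have : l2norm h <= c * l2norm g.
    have hp : 0 < l2norm h by rewrite lt_def h0 l2norm_ge0.
    by rewrite -(ler_pM2l hp) -expr2 hh (le_trans sle)// mulrAC mulrC.
  by rewrite -hh ler_sqr// nnegrE ?l2norm_ge0 ?mulr_ge0 ?l2norm_ge0.
have /choice [S HS] : forall g, exists u : H, (forall x, u x = dot g (T (delta R x))) /\
    l2norm u <= c * l2norm g.
  move=> g; have [u uE un] := square_summable_bound (bound g); exists u.
  split; first by move=> x; rewrite uE.
  by rewrite -ler_sqr// nnegrE ?l2norm_ge0 ?mulr_ge0 ?l2norm_ge0.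
exists S.
  split; last by exists c => f; have [] := HS f.
  move=> a f g; apply: l2P => x; have [-> _] := HS (a *: f + g).
  rewrite dotDl dotZl l2_addE l2_scaleE.
  by have [-> _] := HS f; have [-> _] := HS g.
move=> f g; symmetry; apply: dotP.
have := @has_sum_functional (fun u => dot (T u) g) (c * l2norm g) f.
rewrite (_ : (fun x => f x * dot (T (delta R x)) g) = fun x => f x * (S g x)^*).
  apply=> [a u v|u]; first by rewrite bopD bopZ dotDl dotZl.
  rewrite (le_trans (cauchy_schwarz _ _))// mulrAC ler_wpM2r ?l2norm_ge0//.
by apply/funext => x; have [-> _] := HS g; rewrite -dotC.
Qed.

End Bounded.

Lemma adjoint_ofC T S : adjoint_of T S -> adjoint_of S T.
Proof. by move=> TS f g; rewrite dotC -TS -dotC. Qed.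

(** All but finitely many coordinates of h are smaller than any given r > 0. *)
Lemma l2_decay h (e : nat -> G) : injective e ->
  (fun n => normc (h (e n))) @ \oo --> (0 : R).
Proof.
move=> einj; apply/cvgrPdist_le => r r0.
have [A HA] := l2norm_adherent h (exprn_gt0 2 r0).
have [N HN] : exists N, forall n, (N <= n)%N -> e n \notin (A : seq G).
  elim: (A : seq G) => [|x s [N HN]]; first by exists 0.
  have [[n0 en0]|ne] := pselect (exists n0, e n0 = x).
    exists (maxn N n0.+1) => n; rewrite geq_max => /andP[Nn n0n].
    rewrite inE negb_or HN// andbT -en0; apply/eqP => /einj nn.
    by rewrite nn ltnn in n0n.
  exists N => n Nn; rewrite inE negb_or HN// andbT.
  by apply/eqP => en; apply: ne; exists n.
exists N => // n /= /HN enA; rewrite sub0r normrN ger0_norm ?normc_ge0//.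
rewrite -ler_sqr ?nnegrE ?normc_ge0 ?(ltW r0)//.
have := sum_le_l2norm h (e n |` A)%fset.
rewrite big_fsetU1//=.
move: HA; set s := \sum_(x <- A) _; lra.
Qed.

(** A coefficient that is constant along an infinite orbit vanishes. *)
Lemma l2_const_eq0 h (e : nat -> G) : injective e ->
  (forall n, h (e n) = h (e 0)) -> h (e 0) = 0.
Proof.
move=> einj he; apply: eq0_normc.
have := l2_decay h einj; rewrite (_ : (fun _ => _) = fun=> normc (h (e 0))).
  by move=> h0; apply: (cvg_unique (@Rhausdorff R) (cvg_cst _) h0).
by apply/funext => n; rewrite he.
Qed.

(** On a truncation of f only finitely many coordinates of h n matter; the
    remainder of f is small against the bounded sequence h. *)
Lemma weak_cvg (h : nat -> H) (c : R) f :
  (forall n, l2norm (h n) <= c) ->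
  (forall x, (fun n => normc (h n x)) @ \oo --> (0 : R)) ->
  (fun n => normc (dot f (h n))) @ \oo --> (0 : R).
Proof.
move=> hc hx; apply/cvgrPdist_le => r r0.
have c1 : 0 < `|c| + 1 by rewrite ltr_wpDl.
have r2 : 0 < r / 2 by rewrite divr_gt0.
have [A /(_ _ (fsubset_refl A)) HA] := trunc_dense f (divr_gt0 r2 c1).
have cs : (fun n => \sum_(x <- A) normc (f x) * normc (h n x)) @ \oo --> (0 : R).
  have E0 : \sum_(x <- A) (normc (f x) * 0) = 0 :> R.
    by rewrite big1// => x _; rewrite mulr0.
  have cx x : (fun n => normc (f x) * normc (h n x)) @ \oo --> normc (f x) * 0.
    by apply: cvgM; [exact: cvg_cst|exact: hx].
  by have := @cvg_seq_sum R _ A _ _ cx; rewrite E0.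
have [N _ HN] : \forall n \near \oo,
    `|0 - \sum_(x <- A) normc (f x) * normc (h n x)| <= r / 2.
  by move/cvgrPdist_le : cs; exact.
exists N => // n /= /HN; rewrite !sub0r !normrN ger0_norm; last first.
  by rewrite sumr_ge0// => x _; rewrite mulr_ge0 ?normc_ge0.
move=> sr; rewrite ger0_norm ?normc_ge0//.
rewrite -[f](subrK (trunc A f)) dotDl (le_trans (le_normcD _ _))//.
rewrite (_ : r = r / 2 + r / 2); last by field.
apply: lerD.
  rewrite (le_trans (cauchy_schwarz _ _))//.
  apply: (@le_trans _ _ ((r / 2 / (`|c| + 1)) * (`|c| + 1))); last first.
    by rewrite divfK// gt_eqF.
  rewrite ler_pM ?l2norm_ge0 ?(ltW HA)//.
  by rewrite (le_trans (hc n))// (le_trans (ler_norm c))// lerDl.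
rewrite dot_trunc (le_trans _ sr)//.
elim: (A : seq G) => [|x s IH]; first by rewrite !big_nil [normc _]normc0.
by rewrite !big_cons (le_trans (le_normcD _ _))// lerD// normcM normc_conj.
Qed.

End Delta.

(** * Regular representations and bicommutants *)

Section Regular.
Variables (R : realType) (G : groupType).
Local Notation C := R[i].
Local Notation H := (l2 R G).
Local Notation delta := (@delta R G).
Implicit Types (f g h : H) (a : C) (S T : H -> H) (x y s t : G).
Implicit Types (A B : set (H -> H)) (N : set G).

Lemma l2_reindex (e : G -> G) f (F : G -> C) : injective e ->
  (forall x, normc (F x) = normc (f (e x))) -> F \in @square_summable R G.
Proof.
move=> einj Fe.
have [h <- _] : exists2 h : H, (h : G -> C) = F & l2norm h ^+ 2 <= l2norm f ^+ 2.
  apply: square_summable_bound => B.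
  apply: le_trans (sum_le_l2norm f [fset e x | x in B]%fset).
  rewrite big_imfset/=; last by move=> x y _ _; exact: einj.
  by under eq_bigr do rewrite Fe.
exact: valP.
Qed.

Lemma rreg_subproof t f : (fun x => f (x * t)%g) \in @square_summable R G.
Proof. by apply: (@l2_reindex (fun x => x * t)%g f) => // x y; exact: mulIg. Qed.

Definition rreg t f : H := L2 (rreg_subproof t f).

Lemma flip_subproof f : (fun x => (f x^-1%g)^*) \in @square_summable R G.
Proof.
apply: (@l2_reindex (fun x => x^-1)%g f) => [x y|x]; first exact: invg_inj.
by rewrite normc_conj.
Qed.

(** The modular conjugation T delta_1 |-> T^* delta_1 of L(G), see
    flip_adjoint. *)
Definition flip f : H := L2 (flip_subproof f).

Lemma lregE t f x : lreg t f x = f (t^-1 * x)%g. Proof. by []. Qed.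
Lemma rregE t f x : rreg t f x = f (x * t)%g. Proof. by []. Qed.
Lemma flipE f x : flip f x = (f x^-1%g)^*. Proof. by []. Qed.

Lemma flipK f : flip (flip f) = f.
Proof. by apply: l2P => x; rewrite !flipE conjCK invgK. Qed.

Lemma flip_lreg t f : flip (lreg t f) = rreg t (flip f).
Proof. by apply: l2P => x; rewrite rregE !flipE lregE invgM. Qed.

Lemma flip_rreg t f : flip (rreg t f) = lreg t (flip f).
Proof. by apply: l2P => x; rewrite lregE !flipE rregE invgM invgK. Qed.

Lemma lreg_rreg s t f : lreg s (rreg t f) = rreg t (lreg s f).
Proof. by apply: l2P => x; rewrite !(lregE, rregE) mulgA. Qed.

Lemma lreg_mul s t f : lreg (s * t)%g f = lreg s (lreg t f).
Proof. by apply: l2P => x; rewrite !lregE invgM mulgA. Qed.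

Lemma rreg_mul s t f : rreg (s * t)%g f = rreg s (rreg t f).
Proof. by apply: l2P => x; rewrite !rregE mulgA. Qed.

Lemma lreg_one f : lreg 1%g f = f.
Proof. by apply: l2P => x; rewrite lregE invg1 mul1g. Qed.

Lemma rreg_one f : rreg 1%g f = f.
Proof. by apply: l2P => x; rewrite rregE mulg1. Qed.

Lemma lregK t f : lreg t^-1%g (lreg t f) = f.
Proof. by rewrite -lreg_mul mulVg lreg_one. Qed.

Lemma lregVK t f : lreg t (lreg t^-1%g f) = f.
Proof. by rewrite -lreg_mul mulgV lreg_one. Qed.

Lemma lreg_delta t x : lreg t (delta x) = delta (t * x)%g.
Proof. by apply: l2P => y; rewrite lregE !deltaE -(inj_eq (mulgI t)) mulVKg. Qed.

Lemma rreg_delta t x : rreg t (delta x) = delta (x * t^-1)%g.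
Proof. by apply: l2P => y; rewrite rregE !deltaE -(inj_eq (mulIg t^-1%g)) mulgK. Qed.

Lemma flip_delta x : flip (delta x) = delta x^-1%g.
Proof. by apply: l2P => y; rewrite flipE !deltaE conjC_nat (can2_eq invgK invgK). Qed.

Lemma dot_reindex (e e' : G -> G) f g f' g' : cancel e e' -> cancel e' e ->
  (forall x, f (e x) * (g (e x))^* = f' x * (g' x)^*) -> dot f g = dot f' g'.
Proof. by move=> eK e'K h; exact: (sum_reindex eK e'K h). Qed.

Lemma dot_lreg t f g : dot (lreg t f) g = dot f (lreg t^-1%g g).
Proof. exact: lreg_adjoint. Qed.

Lemma dot_rreg t f g : dot (rreg t f) g = dot f (rreg t^-1%g g).
Proof.
apply: (dot_reindex (mulgVK t) (mulgK t)) => x.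
by rewrite !rregE mulgVK.
Qed.

Lemma dot_flip f g : dot (flip f) (flip g) = dot g f.
Proof.
apply: (dot_reindex invgK invgK) => x.
by rewrite !flipE invgK conjCK mulrC.
Qed.

Lemma flipB f g : flip (f - g) = flip f - flip g.
Proof. by apply: l2P => x; rewrite flipE !l2_addE !l2_oppE !flipE rmorphB. Qed.

Lemma lreg_bounded t : bounded_operator (lreg t : H -> H).
Proof.
split; first by move=> a f g; apply: l2P => x.
exists 1 => f; rewrite mul1r -ler_sqr ?nnegrE ?l2norm_ge0// -lecR -!dotxx.
by rewrite dot_lreg lregK.
Qed.

Lemma rreg_bounded t : bounded_operator (rreg t : H -> H).
Proof.
split; first by move=> a f g; apply: l2P => x.
exists 1 => f; rewrite mul1r -ler_sqr ?nnegrE ?l2norm_ge0// -lecR -!dotxx.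
by rewrite dot_rreg -rreg_mul mulVg rreg_one.
Qed.

Lemma bounded_comp S T : bounded_operator S -> bounded_operator T ->
  bounded_operator (S \o T).
Proof.
move=> bS bT; split.
  by move=> a f g /=; rewrite (bopD bT) (bopZ bT) (bopD bS) (bopZ bS).
have [c c0 hc] := bop_bound bS; have [d d0 hd] := bop_bound bT.
by exists (c * d) => f; rewrite (le_trans (hc _))// -mulrA ler_wpM2l.
Qed.

Lemma bounded_id : bounded_operator (id : H -> H).
Proof. by split=> //; exists 1 => f; rewrite mul1r. Qed.

Lemma bounded_ext S T : bounded_operator S -> bounded_operator T ->
  (forall x, S (delta x) = T (delta x)) -> S = T.
Proof.
move=> bS bT ST; apply/funext => f; apply: l2P => x.
have hs U : bounded_operator U -> has_sum (fun y => f y * (U (delta y)) x) (U f x).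
  move=> bU; have [c _ hc] := bop_bound bU.
  apply: (@has_sum_functional R G (fun h => U h x) c) => [a g h|g].
    by rewrite (bopD bU) (bopZ bU).
  by rewrite (le_trans (normc_le_l2norm _ _)).
apply: (has_sum_unique (hs S bS)); have := hs T bT.
by congr has_sum; apply/funext => y; rewrite ST.
Qed.

(** This set turns out to be L(G), see group_vN_setT. *)
Definition right_equivariant : set (H -> H) := commutant (range rreg).

Lemma reqP T : right_equivariant T <->
  bounded_operator T /\ forall t f, T (rreg t f) = rreg t (T f).
Proof.
split=> [[bT hT]|[bT hT]]; split=> //.
  by move=> t f; have /(congr1 (fun U => U f)) := hT (rreg t) (ex_intro2 _ _ t I erefl).
by move=> _ [t _ <-]; apply/funext => f; exact: hT.
Qed.

Lemma req_bounded T : right_equivariant T -> bounded_operator T.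
Proof. by case. Qed.

Lemma req_rreg T : right_equivariant T -> forall t f, T (rreg t f) = rreg t (T f).
Proof. by case/reqP. Qed.

Lemma req_delta T x : right_equivariant T -> T (delta x) = rreg x^-1%g (T (delta 1%g)).
Proof. by move=> hT; rewrite -(req_rreg hT) rreg_delta invgK mul1g. Qed.

Lemma req_ext S T : right_equivariant S -> right_equivariant T ->
  S (delta 1%g) = T (delta 1%g) -> S = T.
Proof.
move=> hS hT ST; apply: bounded_ext; [exact: req_bounded..|] => x.
by rewrite (req_delta _ hS) (req_delta _ hT) ST.
Qed.

Lemma req_lreg t : right_equivariant (lreg t).
Proof. by apply/reqP; split=> [|s f]; [exact: lreg_bounded|rewrite lreg_rreg]. Qed.

Lemma req_comp S T : right_equivariant S -> right_equivariant T ->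
  right_equivariant (S \o T).
Proof.
move=> hS hT; apply/reqP; split; first by apply: bounded_comp; exact: req_bounded.
by move=> t f /=; rewrite !req_rreg.
Qed.

Lemma req_scale a : right_equivariant (fun f => a *: f).
Proof.
apply/reqP; split; last by move=> t f; apply: l2P => y.
split; first by move=> b f g; rewrite scalerDr !scalerA mulrC.
by exists (normc a) => f; rewrite l2normZ.
Qed.

(** T acts as left convolution by T delta_1: the inner product is the sum over
    y of (T delta_1)(y) f(y^-1 x). *)
Lemma req_conv T f x : right_equivariant T ->
  T f x = dot (T (delta 1%g)) (lreg x (flip f)).
Proof.
move=> hT; have [S bS TS] := adjoint_exists (req_bounded hT).
have Sx : S (delta x) = rreg x^-1%g (flip (T (delta 1%g))).
  apply: l2P => y; rewrite -dot_delta (adjoint_ofC TS) delta_dot.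
  by rewrite (req_delta _ hT) !rregE flipE invgM invgK.
rewrite -dot_delta TS Sx -dot_rreg -[rreg x f]flipK dot_flip flip_rreg.
by [].
Qed.

(** Let S commute with A. For U in L(G), both (S U delta_y)(x) and (U S
    delta_y)(x) are inner products of U delta_1 with vectors that do not depend
    on U; let h be the difference of the two. Then h is orthogonal to A
    delta_1, because A commutes with S, hence to T delta_1, so T commutes with
    S as well. *)
Lemma bicommutant_span A T : A `<=` right_equivariant -> right_equivariant T ->
  perp (perp [set U (delta 1%g) | U in A]) (T (delta 1%g)) ->
  commutant (commutant A) T.
Proof.
move=> hA hT VT; split; first exact: req_bounded.
move=> S [bS SA]; have [S' bS' SS'] := adjoint_exists bS.
have bT := req_bounded hT.
apply: bounded_ext; [exact: bounded_comp..|] => y; apply: l2P => x /=.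
pose h := rreg y (S' (delta x)) - lreg x (flip (S (delta y))).
have hE U : right_equivariant U ->
    dot (U (delta 1%g)) h = S (U (delta y)) x - U (S (delta y)) x.
  move=> hU; rewrite /h dotBr -req_conv//; congr (_ - _).
  by rewrite -dot_delta SS' (req_delta y hU) dot_rreg invgK.
suff : dot (T (delta 1%g)) h = 0 by rewrite hE// => /eqP; rewrite subr_eq0 => /eqP.
rewrite dotC VT ?rmorph0// => _ [U AU <-]; rewrite hE; last exact: hA.
have /(congr1 (fun W => W (delta y))) /= -> := SA _ AU.
by rewrite subrr.
Qed.

Lemma commutantS A B : A `<=` B -> commutant B `<=` commutant A.
Proof. by move=> AB T [bT hT]; split=> // S /AB; exact: hT. Qed.

Lemma sub_bicommutant A :
  A `<=` @bounded_operator R G -> A `<=` commutant (commutant A).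
Proof. by move=> bA T AT; split; [exact: bA|move=> S [_ /(_ _ AT)]]. Qed.

Lemma commutant3 A : A `<=` @bounded_operator R G ->
  commutant (commutant (commutant A)) = commutant A.
Proof.
move=> bA; apply/seteqP; split; first exact/commutantS/sub_bicommutant.
by apply: sub_bicommutant => T [].
Qed.

Lemma commutant_comp A S T : commutant A S -> commutant A T -> commutant A (S \o T).
Proof.
move=> [bS hS] [bT hT]; split; first exact: bounded_comp.
move=> U AU; apply/funext => f /=.
have /(congr1 (fun W => W f)) /= -> := hT U AU.
by have /(congr1 (fun W => W (T f))) /= -> := hS U AU.
Qed.

Lemma commutant_id A : commutant A id.
Proof. by split; first exact: bounded_id. Qed.

(** Take adjoints in the relation saying that T commutes with the adjoints of
    the elements of A. *)
Lemma commutant_adjoint A S T :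
  (forall U, A U -> exists2 U', A U' & adjoint_of U U') ->
  commutant A T -> bounded_operator S -> adjoint_of T S -> commutant A S.
Proof.
move=> Astar [bT hT] bS TS; split=> // U AU; have [U' AU' UU'] := Astar _ AU.
apply/funext => f; apply: l2P => x /=; rewrite -!dot_delta.
rewrite (adjoint_ofC TS) !UU' (adjoint_ofC TS).
by have /(congr1 (fun W => W (delta x))) /= -> := hT U' AU'.
Qed.

Lemma von_neumann_commutant A : A `<=` @bounded_operator R G ->
  (forall U, A U -> exists2 U', A U' & adjoint_of U U') ->
  von_neumann_algebra (commutant A).
Proof.
move=> bA Astar; split; [by move=> T []| |exact: commutant3].
by move=> T S; exact: commutant_adjoint.
Qed.

Lemma von_neumann_bicommutant A : A `<=` @bounded_operator R G ->
  (forall U, A U -> exists2 U', A U' & adjoint_of U U') ->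
  von_neumann_algebra (commutant (commutant A)).
Proof.
move=> bA Astar; apply: von_neumann_commutant => [T [] //|T hT].
have [S bS TS] := adjoint_exists (proj1 hT).
by exists S => //; exact: commutant_adjoint hT bS TS.
Qed.

Definition subgroup_set N := [/\ N 1%g, forall x y, N x -> N y -> N (x * y)%g
  & forall x, N x -> N x^-1%g].

Lemma restr_subproof N f :
  (fun x => if `[< N x >] then f x else 0) \in @square_summable R G.
Proof.
have [h <- _] : exists2 h : H, (h : G -> C) = (fun x => if `[< N x >] then f x else 0)
    & l2norm h ^+ 2 <= l2norm f ^+ 2.
  apply: square_summable_bound => B; apply: le_trans (sum_le_l2norm f B).
  apply: ler_sum => x _; case: ifP => // _.
  by rewrite [normc _]normc0 expr0n sqr_ge0.
exact: valP.
Qed.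

Definition restr N f : H := L2 (restr_subproof N f).

Lemma restrE N f x : restr N f x = if `[< N x >] then f x else 0.
Proof. by []. Qed.

Lemma restr_bounded N : bounded_operator (restr N).
Proof.
split.
  move=> a f g; apply: l2P => x; rewrite !(l2_addE, l2_scaleE, restrE).
  by case: ifP => // _; rewrite mulr0 addr0.
exists 1 => f; rewrite mul1r -ler_sqr ?nnegrE ?l2norm_ge0//.
have [h hE hf] : exists2 h : H, (h : G -> C) = restr N f &
    l2norm h ^+ 2 <= l2norm f ^+ 2.
  apply: square_summable_bound => B; apply: le_trans (sum_le_l2norm f B).
  apply: ler_sum => x _; rewrite restrE; case: ifP => // _.
  by rewrite [normc _]normc0 expr0n sqr_ge0.
by have <- : h = restr N f by apply: l2P => x; rewrite hE.
Qed.

(** Cutting off to N commutes with translations by N, so an element of L(N)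
    maps delta_1 to a vector supported on N; conversely use bicommutant_span. *)
Lemma group_vNP N T : subgroup_set N -> group_vN N T <->
  right_equivariant T /\ forall x, ~ N x -> T (delta 1%g) x = 0.
Proof.
move=> [N1 NM NV]; split=> [hT|[hT TN]].
  have rT : right_equivariant T.
    apply: commutantS hT => _ [t _ <-]; split; first exact: rreg_bounded.
    by move=> _ [s _ <-]; apply/funext => f /=; rewrite lreg_rreg.
  split=> // x Nx.
  have : commutant (@lreg R G @` N) (restr N).
    split; first exact: restr_bounded.
    move=> _ [s Ns <-]; apply/funext => f; apply: l2P => y /=.
    rewrite (_ : `[< N (s^-1 * y)%g >] = `[< N y >])//.
    apply: asbool_equiv_eq; split=> [h|h]; last by apply: NM => //; exact: NV.
    by rewrite -(mulVKg s y); exact: NM.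
  move=> /(proj2 hT) /(congr1 (fun W : H -> H => W (delta 1%g) x)) /=.
  rewrite (_ : restr N (delta 1%g) = delta 1%g) => [->|].
    by case: asboolP.
  apply: l2P => y; rewrite restrE; case: asboolP => // Ny.
  by rewrite deltaE; case: eqP => // y1; case: Ny; rewrite y1.
apply: bicommutant_span => //; first by move=> _ [t _ <-]; exact: req_lreg.
move=> h hh; rewrite -(dot0l (0 : H)); apply: eq_dot => x; rewrite l2_zeroE mul0r.
have [Nx|Nx] := pselect (N x); last by rewrite TN// rmorph0 mulr0.
have := hh (delta x); rewrite delta_dot => hx.
suff : (h x)^* = 0 by move=> /eqP; rewrite conjC_eq0 => /eqP ->; rewrite mul0r.
apply: hx; exists (lreg x); first by exists x.
by rewrite lreg_delta mulg1.
Qed.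

Lemma group_vN_setT : group_vN [set: G] = right_equivariant.
Proof.
apply/seteqP; split=> T; rewrite group_vNP//; first by case.
by move=> hT; split=> // x [].
Qed.

Lemma group_vN_von_neumann N : subgroup_set N -> von_neumann_algebra (@group_vN R G N).
Proof.
move=> [_ _ NV]; apply: von_neumann_bicommutant.
  by move=> _ [t _ <-]; exact: lreg_bounded.
move=> _ [t Nt <-]; exists (lreg t^-1%g); last exact: lreg_adjoint.
by exists t^-1%g => //; exact: NV.
Qed.

Lemma group_vNS N N' : N `<=` N' -> @group_vN R G N `<=` group_vN N'.
Proof. by move=> NN; apply/commutantS/commutantS/image_subset. Qed.

Definition conj_op t T : H -> H := lreg t \o T \o lreg t^-1%g.
Definition Ad t f : H := lreg t (rreg t f).

Lemma AdE t f x : Ad t f x = f (t^-1 * x * t)%g.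
Proof. by []. Qed.

Lemma conj_op_delta t T : right_equivariant T ->
  conj_op t T (delta 1%g) = Ad t (T (delta 1%g)).
Proof.
by move=> hT; rewrite /conj_op /= lreg_delta mulg1 (req_delta _ hT) invgK.
Qed.

Lemma req_conj_op t T : right_equivariant T -> right_equivariant (conj_op t T).
Proof.
by move=> hT; apply: req_comp; [apply: req_comp => //|]; exact: req_lreg.
Qed.

Lemma G_invariantP A : (forall t T, A T -> A (conj_op t T)) -> G_invariant A.
Proof.
move=> h t; apply/seteqP; split=> [_ [T AT <-]|T AT]; first exact: h.
exists (conj_op t^-1%g T); first exact: h.
by apply/funext => f; rewrite /conj_op /= invgK !lregVK.
Qed.

(** Conjugation moves Fourier coefficients along conjugacy classes. *)
Lemma normal_group_vN N : subgroup_set N ->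
  (forall t x, N (t^-1 * x * t)%g -> N x) ->
  von_neumann_subalgebra (group_vN [set: G]) (@group_vN R G N) /\
  G_invariant (@group_vN R G N).
Proof.
move=> gN nN; split.
  by split; [exact: group_vN_von_neumann|exact: group_vNS].
apply: G_invariantP => t T /(group_vNP _ gN) [hT TN].
apply/(group_vNP _ gN); split; first exact: req_conj_op.
move=> x Nx; rewrite conj_op_delta// AdE TN//.
by move=> /nN.
Qed.

End Regular.

(** * The conditional expectation onto an invariant subalgebra *)

Section InvariantSubalgebra.
Variables (R : realType) (G : groupType).
Local Notation C := R[i].
Local Notation H := (l2 R G).
Local Notation delta := (@delta R G).
Variable M : set (H -> H).
Hypothesis Msub : von_neumann_subalgebra (group_vN [set: G]) M.
Hypothesis Minv : G_invariant M.
Implicit Types (f g h v w : H) (a : C) (S T : H -> H) (x y s t : G).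

Lemma subalg_req T : M T -> right_equivariant T.
Proof. by move=> MT; rewrite -group_vN_setT; have [_] := Msub; apply. Qed.

Lemma subalg_bicommutant : commutant (commutant M) = M.
Proof. by have [[]] := Msub. Qed.

Lemma subalg_id : M id.
Proof. by rewrite -subalg_bicommutant; exact: commutant_id. Qed.

Lemma subalg_comp S T : M S -> M T -> M (S \o T).
Proof. by rewrite -subalg_bicommutant; exact: commutant_comp. Qed.

Lemma subalg_adjoint T : M T -> exists2 S, M S & adjoint_of T S.
Proof.
move=> MT; have [S bS TS] := adjoint_exists (req_bounded (subalg_req MT)).
by exists S => //; have [[_ Mstar _] _] := Msub; exact: Mstar MT bS TS.
Qed.

Lemma subalg_conj t T : M T -> M (conj_op t T).
Proof. by move=> MT; rewrite -(Minv t); exists T. Qed.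

Definition subalg_perp : set H := perp [set T (delta 1%g) | T in M].
(** The closure of M delta_1, that is L2(M). *)
Definition subalg_l2 : set H := perp subalg_perp.
Local Notation W := subalg_perp.
Local Notation V := subalg_l2.

(** The vector T delta_1 decides whether T lies in M, by bicommutant_span. *)
Lemma subalgP T : M T <-> right_equivariant T /\ V (T (delta 1%g)).
Proof.
split=> [MT|[hT VT]].
  split; first exact: subalg_req.
  by move=> w Ww; rewrite dotC Ww ?rmorph0//; exists T.
rewrite -subalg_bicommutant; apply: bicommutant_span => //.
exact: subalg_req.
Qed.

Lemma subalg_l2_delta1 : V (delta 1%g).
Proof. by have /subalgP [] := subalg_id. Qed.

Lemma subalg_lreg t : V (delta t) -> M (lreg t).
Proof.
move=> Vt; apply/subalgP; split; first exact: req_lreg.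
by rewrite lreg_delta mulg1.
Qed.

Lemma dot_subalg_perp v w : V v -> W w -> dot v w = 0.
Proof. by move=> Vv Ww; rewrite dotC Vv ?rmorph0. Qed.

Lemma subalg_perp_stable T w : M T -> W w -> W (T w).
Proof.
move=> MT Ww; have [S MS TS] := subalg_adjoint MT.
move=> _ [U MU <-]; rewrite -(adjoint_ofC TS); apply: Ww.
by exists (S \o U) => //; exact: subalg_comp.
Qed.

Lemma subalg_l2_stable T v : M T -> V v -> V (T v).
Proof.
move=> MT Vv w Ww; have [S MS TS] := subalg_adjoint MT.
by rewrite -(adjoint_ofC TS); apply: Vv; exact: subalg_perp_stable.
Qed.

Lemma flip_adjoint S T : right_equivariant T -> adjoint_of T S ->
  flip (T (delta 1%g)) = S (delta 1%g).
Proof.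
move=> hT TS; apply: l2P => x; rewrite flipE -[RHS]dot_delta.
by rewrite (adjoint_ofC TS) delta_dot (req_delta x hT) rregE mul1g.
Qed.

Lemma subalg_perp_flip w : W w -> W (flip w).
Proof.
move=> Ww _ [T MT <-]; have [S MS TS] := subalg_adjoint MT.
rewrite -[T _]flipK dot_flip dotC (flip_adjoint (subalg_req MT) TS).
by rewrite Ww ?rmorph0//; exists S.
Qed.

Lemma subalg_l2_flip v : V v -> V (flip v).
Proof.
move=> Vv w Ww; rewrite -[w]flipK dot_flip dotC Vv ?rmorph0//.
exact: subalg_perp_flip.
Qed.

Lemma dot_Ad t f g : dot (Ad t f) g = dot f (Ad t^-1%g g).
Proof. by rewrite /Ad dot_lreg dot_rreg -lreg_rreg. Qed.

Lemma subalg_perp_Ad t w : W w -> W (Ad t w).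
Proof.
move=> Ww _ [T MT <-]; rewrite -[t]invgK -dot_Ad.
rewrite -conj_op_delta; last exact: subalg_req.
by apply: Ww; exists (conj_op t^-1%g T) => //; exact: subalg_conj.
Qed.

Lemma subalg_l2_Ad t v : V v -> V (Ad t v).
Proof.
move=> Vv w Ww; rewrite -[t]invgK -dot_Ad; apply: Vv; exact: subalg_perp_Ad.
Qed.

(** The conditional expectation onto M, on the level of vectors. *)
Lemma l2_proj_ex f : exists p, V p /\ W (f - p).
Proof.
by have [p] := orthogonal_projection [set T (delta 1%g) | T in M] f; exists p.
Qed.

Definition l2_proj f : H := projT1 (cid (l2_proj_ex f)).
Local Notation P := l2_proj.

Lemma l2_proj_mem f : V (P f).
Proof. by rewrite /l2_proj; case: cid => p []. Qed.

Lemma l2_proj_perp f : W (f - P f).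
Proof. by rewrite /l2_proj; case: cid => p []. Qed.

Lemma l2_proj_unique f p : V p -> W (f - p) -> P f = p.
Proof.
move=> Vp Wp; apply/eqP; rewrite -subr_eq0; apply/eqP/dotxx_eq0.
have Vd : V (P f - p) by exact: perp_sub (l2_proj_mem f) Vp.
apply: dot_subalg_perp => //.
have -> : P f - p = (f - p) - (f - P f).
  by apply: l2P => x; rewrite !(l2_addE, l2_oppE); ring.
by apply: perp_sub => //; exact: l2_proj_perp.
Qed.

Lemma l2_proj_id v : V v -> P v = v.
Proof. by move=> Vv; apply: l2_proj_unique => // b _; rewrite subrr dot0r. Qed.

Lemma dot_l2_proj f g : dot (P f) g = dot f (P g).
Proof.
have h u u' : dot (P u) u' = dot (P u) (P u').
  apply/eqP; rewrite -subr_eq0 -dotBr; apply/eqP.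
  by apply: dot_subalg_perp; [exact: l2_proj_mem|exact: l2_proj_perp].
by rewrite h dotC -h -dotC.
Qed.

(** The vector E(v_t) delta_1, for E the conditional expectation onto M. *)
Definition cexp : G -> H := locked (fun t => P (delta t)).

Lemma cexpE t : cexp t = P (delta t).
Proof. by rewrite /cexp -lock. Qed.

Lemma cexp_mem t : V (cexp t). Proof. by rewrite cexpE; exact: l2_proj_mem. Qed.

(** The projection is self-adjoint, so cexp x represents the evaluation at x on
    L2(M). *)
Lemma dot_cexp v x : V v -> dot v (cexp x) = v x.
Proof. by move=> Vv; rewrite cexpE -dot_l2_proj l2_proj_id// dot_delta. Qed.

Lemma flip_cexp t : flip (cexp t) = cexp t^-1%g.
Proof.
rewrite [RHS]cexpE; symmetry; apply: l2_proj_unique.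
  exact/subalg_l2_flip/cexp_mem.
by rewrite -flip_delta -flipB cexpE; apply: subalg_perp_flip; exact: l2_proj_perp.
Qed.

Lemma Ad_cexp s t : Ad s (cexp t) = cexp (s * t * s^-1)%g.
Proof.
rewrite [RHS]cexpE; symmetry; apply: l2_proj_unique; first exact/subalg_l2_Ad/cexp_mem.
have -> : delta (s * t * s^-1)%g = Ad s (delta t).
  by rewrite /Ad rreg_delta lreg_delta mulgA.
have -> : Ad s (delta t) - Ad s (cexp t) = Ad s (delta t - cexp t) by apply: l2P.
by rewrite cexpE; apply: subalg_perp_Ad; exact: l2_proj_perp.
Qed.

(** E(m v_t) = m E(v_t) for m in M; the left side is the coefficient at x of
    the projection of v v_t, the right side that of v E(v_t). Both are inner
    products with v, so the identity passes from M delta_1 to L2(M). *)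
Lemma cexp_right v t x : V v ->
  dot v (rreg t (cexp x)) = dot v (lreg x (flip (cexp t))).
Proof.
move=> Vv; apply/eqP; rewrite -subr_eq0 -dotBr; apply/eqP.
apply: dot_subalg_perp => // _ [T MT <-]; have hT := subalg_req MT.
rewrite dotBr -req_conv// -[t]invgK -dot_rreg invgK -(req_delta t hT).
rewrite cexpE -dot_l2_proj dot_delta; apply/eqP; rewrite subr_eq0; apply/eqP.
rewrite cexpE; congr (l2_fun _ x); apply: l2_proj_unique.
  by apply: subalg_l2_stable => //; exact: l2_proj_mem.
rewrite -(bopB (req_bounded hT)); apply: subalg_perp_stable => //.
exact: l2_proj_perp.
Qed.

(** E(v_t v) = E(v_t) v, obtained from cexp_right by taking adjoints. *)
Lemma cexp_left v t x : V v ->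
  dot (lreg t v) (cexp x) = dot (cexp t) (lreg x (flip v)).
Proof.
move=> Vv; rewrite -dot_flip flip_lreg flip_cexp dotC -[t in rreg t _]invgK.
rewrite -[t]invgK dot_rreg !invgK cexp_right; last exact: subalg_l2_flip.
rewrite flip_cexp invgK -dotC dot_lreg invgK.
by [].
Qed.

(** From v_t m = (v_t m v_{t^-1}) v_t follows E(v_t) m = (v_t m v_{t^-1})
    E(v_t) for m in M, that is, v_{t^-1} E(v_t) commutes with M. *)
Lemma cexp_commute v t x : V v ->
  dot (cexp t) (lreg x (flip v)) = dot (Ad t v) (lreg x (flip (cexp t))).
Proof.
move=> Vv; rewrite -cexp_left// -cexp_right; last exact: subalg_l2_Ad.
have := dot_rreg t^-1%g (Ad t v) (cexp x); rewrite invgK => <-.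
by rewrite /Ad -lreg_rreg -rreg_mul mulVg rreg_one.
Qed.

End InvariantSubalgebra.

(** * Sums of two roots of unity *)

Section RootsOfUnity.

Local Notation toC := (map_poly (intr : int -> algC)).

Lemma closed_prim_root (K : closedFieldType) n :
  [pchar K] =i pred0 -> (0 < n)%N -> exists z : K, n.-primitive_root z.
Proof.
move=> /pcharf0P K0 n0.
have [r Dp] := closed_field_poly_normal ('X^n - 1 : {poly K}).
rewrite (monicP _) ?monicXnsubC // scale1r in Dp.
have rn1 : all n.-unity_root r by apply/allP=> z; rewrite -root_prod_XsubC -Dp.
have sz_r : (n < (size r).+1)%N by rewrite -(size_prod_XsubC r id) -Dp size_XnsubC.
have [|z] := hasP (has_prim_root n0 rn1 _ sz_r); last by exists z.
by rewrite -separable_prod_XsubC -Dp separable_Xn_sub_1 // K0 -lt0n.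
Qed.

(** Factor X^n - 1 into cyclotomic polynomials. *)
Lemma unity_root_Cyclotomic (K : fieldType) n (z : K) : (0 < n)%N ->
  (z ^+ n == 1) = has (fun d => root (map_poly intr 'Phi_d) z) (divisors n).
Proof.
move=> n0.
have := congr1 (fun p : {poly int} => (map_poly intr p).[z]) (prod_Cyclotomic n0).
rewrite rmorph_prod rmorphB rmorph1 /= map_polyXn.
rewrite hornerD hornerN hornerXn hornerC horner_prod => E.
by rewrite -subr_eq0 -E prodf_seq_eq0.
Qed.

Lemma root_Cyclotomic_prim (K : fieldType) n (z : K) :
  n.-primitive_root z -> root (map_poly intr 'Phi_n) z.
Proof.
move=> zn; have n0 := prim_order_gt0 zn.
have : z ^+ n == 1 by rewrite prim_expr_order.
rewrite unity_root_Cyclotomic// => /hasP [d]; rewrite -dvdn_divisors// => dn zd.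
have d0 := dvdn_gt0 n0 dn.
suff : (n %| d)%N by move=> nd; have /eqP <- : d == n by rewrite eqn_dvd dn.
rewrite (prim_order_dvd zn) unity_root_Cyclotomic//.
by apply/hasP; exists d => //; rewrite -dvdn_divisors.
Qed.

(** The cyclotomic polynomial is the minimal polynomial of w over the
    rationals, and it is monic, so that the quotient is integral. *)
Lemma Cyclotomic_dvdp n (p : {poly int}) (w : algC) :
  n.-primitive_root w -> root (toC p) w -> exists q, p = q * 'Phi_n.
Proof.
move=> wn pw.
have [m [mE _] mdvd] := minCpolyP w.
have : root (map_poly ratr (map_poly (intr : int -> rat) p)) w.
  by rewrite -map_poly_comp (eq_map_poly (g := intr))// => a /=; rewrite rmorph_int.
rewrite mdvd.
have -> : m = map_poly intr 'Phi_n.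
  apply: (map_inj_poly (fmorph_inj (ratr : rat -> algC))) => //; first exact: rmorph0.
  rewrite -mE (minCpoly_cyclotomic wn) -(Cintr_Cyclotomic wn).
  by rewrite -map_poly_comp; apply: eq_map_poly => a /=; rewrite rmorph_int.
rewrite dvdp_rat_int => /dvdpP_int [q ->]; exists q; rewrite mulrC; congr (_ * _).
exact/zprimitive_monic/Cyclotomic_monic.
Qed.

(** The automorphism z |-> z^-1 of a cyclotomic field, which replaces complex
    conjugation. If p and the n-th cyclotomic polynomial were coprime, a Bezout
    relation evaluated at z would give a nonzero integer that vanishes in K. So
    they have a common root among the algebraic complex numbers, and the
    cyclotomic polynomial divides p; its roots are stable under inversion. *)
Lemma root_prim_inv (K : fieldType) n (z : K) (p : {poly int}) :
  [pchar K] =i pred0 -> n.-primitive_root z ->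
  root (map_poly intr p) z -> root (map_poly intr p) z^-1.
Proof.
move=> K0 zn pz; have n0 := prim_order_gt0 zn.
have [w wn] := C_prim_root_exists n0.
have zVn : n.-primitive_root z^-1.
  have -> : z^-1 = z ^+ n.-1.
    have z1 : z * z ^+ n.-1 = 1 by rewrite -exprS prednK// prim_expr_order.
    have z0 : z != 0.
      by apply/eqP => zE; move: z1; rewrite zE mul0r => /esym/eqP; rewrite oner_eq0.
    by apply: (mulfI z0); rewrite z1 divff.
  rewrite (prim_root_exp_coprime n.-1 zn).
  by rewrite -[in X in coprime _ X](prednK n0) coprimenS.
suff [q ->] : exists q, p = q * 'Phi_n.
  by rewrite rmorphM /= rootM root_Cyclotomic_prim ?orbT.
have [cop|ncop] := boolP (coprimep 'Phi_n p).
  have /Bezout_coprimepP [[u v]] := cop; move/eqpP => [[c1 c2] /andP [/= c1n c2n] E].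
  have := congr1 (fun r : {poly int} => (map_poly intr r).[z]) E.
  rewrite /= !map_polyZ rmorphD !rmorphM rmorph1 /= !hornerZ hornerD !hornerM hornerC.
  rewrite (rootP (root_Cyclotomic_prim zn)) (rootP pz) !mulr0 addr0 mulr0 mulr1.
  move: K0 => /pcharf0P K0 /esym/eqP c20; exfalso; move: c2n; apply/negP; rewrite negbK.
  case: (c2) c20 => m; first by rewrite -[m%:~R]/(m%:R) K0.
  by rewrite -[_%:~R]/(- (m.+1%:R)) oppr_eq0 K0.
have g1 : size (toC (gcdp 'Phi_n p)) != 1%N.
  rewrite size_map_poly_id0; last first.
    by rewrite intr_eq0 lead_coef_eq0 gcdp_eq0 negb_and monic_neq0 ?Cyclotomic_monic.
  by move: ncop; rewrite /coprimep.
have [w' gw'] : exists w', root (toC (gcdp 'Phi_n p)) w'.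
  by apply/closed_rootP.
have dvdr (r s : {poly int}) (x : algC) : r %| s -> root (toC r) x -> root (toC s) x.
  move=> /Pdiv.Idomain.dvdpP [[c q] /= c0 E] rx.
  have := congr1 (fun r : {poly int} => (toC r).[x]) E.
  rewrite /= map_polyZ rmorphM /= hornerZ hornerM (rootP rx) mulr0 => /eqP.
  by rewrite mulf_eq0 intr_eq0 (negPf c0).
apply: (@Cyclotomic_dvdp _ _ w'); last exact: dvdr (dvdp_gcdr _ _) gw'.
have := dvdr _ _ _ (dvdp_gcdl _ _) gw'.
by rewrite (Cintr_Cyclotomic wn) root_cyclotomic.
Qed.

(** Inverting all the roots of unity in the relation gives 1 + 1/e = 1/y' +
    y/e. Together the two relations say (y - y') (y y' + e) = 0. The inversion
    is carried out in an algebraic closure, where e, y and y' are powers of one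
    primitive root. *)
Lemma sum_roots_of_unity (k : countFieldType) (e y y' : k) :
  [pchar k] =i pred0 ->
  (exists n, (0 < n)%N /\ e ^+ n = 1) -> (exists n, (0 < n)%N /\ y ^+ n = 1) ->
  (exists n, (0 < n)%N /\ y' ^+ n = 1) ->
  1 + e = y' + e / y -> e = -1 \/ y = y'.
Proof.
move=> k0 [n1 [n10 e1]] [n2 [n20 y1]] [n3 [n30 y'1]] E.
have [K [f _]] := countable_algebraic_closure k.
have K0 : [pchar K] =i pred0 by move=> p; rewrite (fmorph_pchar f).
pose n := (n1 * n2 * n3)%N.
have n0 : (0 < n)%N by rewrite !muln_gt0 n10 n20.
have [z zn] := closed_prim_root K0 n0.
have pw x m : (m %| n)%N -> x ^+ m = 1 -> exists i : 'I_n, f x = z ^+ i.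
  move=> mn xm; have h : f x ^+ n = 1.
    by rewrite -rmorphXn -(divnK mn) mulnC exprM xm expr1n rmorph1.
  by have [i ->] := prim_rootP zn h; exists i.
have [i ei] : exists i : 'I_n, f e = z ^+ i.
  by apply: pw e1; rewrite /n -mulnA dvdn_mulr.
have [j yj] : exists i : 'I_n, f y = z ^+ i.
  by apply: pw y1; rewrite /n mulnAC dvdn_mull.
have [l y'l] : exists i : 'I_n, f y' = z ^+ i.
  by apply: pw y'1; rewrite /n dvdn_mull.
pose p : {poly int} := 1 + 'X^i - 'X^l - 'X^(i + (n - j)).
have z0 : z != 0.
  apply/eqP => zE; have := prim_expr_order zn; rewrite zE expr0n gtn_eqF//.
  by move/esym/eqP; rewrite oner_eq0.
have pE (x : K) : (map_poly intr p).[x] = 1 + x ^+ i - x ^+ l - x ^+ (i + (n - j)).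
  rewrite /p !(rmorphB, rmorphD, rmorph1) /= !map_polyXn.
  by rewrite !(hornerD, hornerN, hornerXn, hornerC).
have fey : f (e / y) = z ^+ (i + (n - j)).
  rewrite rmorphM fmorphV /= ei yj exprD exprB ?(ltnW (ltn_ord j)) ?unitfE//.
  by rewrite (prim_expr_order zn) mul1r.
have : root (map_poly intr p) z.
  rewrite /root pE -fey -ei -y'l -(rmorph1 f) -rmorphD -!rmorphB /= E.
  have -> : y' + e / y - y' - e / y = 0 by ring.
  by rewrite rmorph0.
move=> /(root_prim_inv K0 zn) /rootP.
rewrite pE !exprVn -fey -ei -y'l -!fmorphV -(rmorph1 f) -rmorphD -!rmorphB /=.
move=> /eqP; rewrite fmorph_eq0 => /eqP E'.
have e0 : e != 0 by apply: contra z0; rewrite -(fmorph_eq0 f) ei expf_eq0 => /andP[].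
have y0 : y != 0 by apply: contra z0; rewrite -(fmorph_eq0 f) yj expf_eq0 => /andP[].
have y'0 : y' != 0 by apply: contra z0; rewrite -(fmorph_eq0 f) y'l expf_eq0 => /andP[].
have [->|yy] := eqVneq y y'; [by right|left].
have y'E : y' = 1 + e - e / y by rewrite E addrK.
have : (y - y') * (y * y' + e) = 0.
  have : e * y * y' * (1 + e^-1 - y'^-1 - (e / y)^-1) = 0 by rewrite E' mulr0.
  have : (1 + e) * y = y' * y + e by rewrite E mulrDl divfK.
  have -> : e * y * y' * (1 + e^-1 - y'^-1 - (e / y)^-1) =
     y * y' * (e + 1) - e * y - y * y * y' by field; rewrite e0 y0 y'0.
  move=> Ea Eb.
  have -> : (y - y') * (y * y' + e) =
      - (y * y' * (e + 1) - e * y - y * y * y') + y' * ((1 + e) * y - y' * y - e).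
    by ring.
  by rewrite Eb Ea; ring.
move=> /eqP; rewrite mulf_eq0 subr_eq0 (negPf yy) /= addr_eq0 => /eqP yye.
have y'E2 : y' = - (e / y) by apply: (mulfI y0); rewrite yye; field.
have : 1 + e = 0 by rewrite E y'E2 addNr.
by move/eqP; rewrite addrC addr_eq0 => /eqP.
Qed.
End RootsOfUnity.

(** * Coefficient functions satisfying the braid relation *)

Section BraidRelation.
Variables (R : realType) (k : countFieldType) (k0 : [pchar k] =i pred0).
Variables (phi : k -> R[i]) (b : k) (K : R).
Hypothesis b0 : b != 0.
Hypotheses (phi0 : phi 0 = 0) (phi1 : phi 1 = 0) (phib : phi b != 0).
Hypothesis phi_bounded : forall c, normc (phi c) <= K.
Hypothesis phi_decay : forall u : nat -> k, injective u -> (forall n, u n != 0) ->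
  (fun n => normc (phi (u n))) @ \oo --> (0 : R).
Hypothesis phi_braid : forall c y, c != 0 -> y != 0 ->
  let z := 1 - c * (1 - y) / b in phi c * phi y = phi z * phi (c * y / z).

Lemma phi_supp c : phi c != 0 -> c != 0.
Proof. by apply: contra => /eqP ->; rewrite phi0. Qed.

(** With e = cy/b fixed, the braid relation moves y along this Moebius map. Its
    fixed points are 1 and e, and its multiplier is e. *)
Definition braid_map (e y : k) : k := 1 + e - e / y.

Lemma braid_mapE e y : e != 0 -> y != 0 ->
  phi (b * e / y) * phi y = phi (b * e / braid_map e y) * phi (braid_map e y).
Proof.
move=> e0 y0; rewrite phi_braid ?mulf_neq0 ?invr_eq0//=.
rewrite (_ : 1 - b * e / y * (1 - y) / b = braid_map e y); last first.
  by rewrite /braid_map; field; rewrite b0 y0.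
by rewrite (_ : b * e / y * y = b * e) ?divfK// mulrC.
Qed.

Lemma braid_iter e y n : e != 0 -> phi (b * e / y) * phi y != 0 ->
  let u := iter n (braid_map e) y in
  u != 0 /\ phi (b * e / u) * phi u = phi (b * e / y) * phi y.
Proof.
move=> e0 g0; elim: n => [|n [un0 IH]] /=.
  by split=> //; apply: phi_supp; apply: contraNneq g0 => ->; rewrite mulr0.
rewrite -braid_mapE// IH; split=> //; apply: phi_supp.
by apply: contraNneq g0 => pE; rewrite -IH braid_mapE// pE mulr0.
Qed.

(** Along the orbit phi (b e / u) * phi u is a nonzero constant, so that phi u
    stays away from 0; an injective orbit would contradict the decay of phi. *)
Lemma braid_recurrent e y : e != 0 -> phi (b * e / y) * phi y != 0 ->
  exists i j, (i < j)%N /\ iter i (braid_map e) y = iter j (braid_map e) y.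
Proof.
move=> e0 g0; apply: contrapT => h.
have uinj : injective (fun n => iter n (braid_map e) y).
  move=> i j uij; apply/eqP; apply: contrapT => /negP; rewrite neq_ltn => /orP[ij|ij].
    by apply: h; exists i, j.
  by apply: h; exists j, i.
have K1 : 0 < `|K| + 1 by rewrite ltr_wpDl.
have := phi_decay uinj (fun n => (braid_iter n e0 g0).1).
move=> /cvgrPdist_lt h0.
have gp : 0 < normc (phi (b * e / y) * phi y) / (`|K| + 1).
  rewrite divr_gt0// lt_def normc_ge0 andbT.
  by apply: contra g0 => /eqP/eq0_normc ->.
have [N _ /(_ N (leqnn N)) /=] := h0 _ gp.
have [_ <-] := braid_iter N e0 g0.
set u := iter N _ _; rewrite sub0r normrN ger0_norm ?normc_ge0//.
rewrite ltr_pdivlMr// normcM => lt.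
have : normc (phi (b * e / u)) * normc (phi u) <= normc (phi u) * (`|K| + 1).
  rewrite mulrC ler_wpM2l ?normc_ge0// (le_trans (phi_bounded _))//.
  by rewrite (le_trans (ler_norm K))// lerDl.
by rewrite leNgt lt.
Qed.

Definition torsion (x : k) := exists n, (0 < n)%N /\ x ^+ n = 1.

Lemma torsionM x y : torsion x -> torsion y -> torsion (x * y).
Proof.
move=> [n [n0 xn]] [m [m0 ym]]; exists (n * m)%N; rewrite muln_gt0 n0 m0.
by rewrite exprMn exprM xn expr1n mulnC exprM ym expr1n mulr1.
Qed.

Lemma torsionV x : torsion x -> torsion x^-1.
Proof. by move=> [n [n0 xn]]; exists n; rewrite exprVn xn invr1. Qed.

(** A Moebius map with multiplier e that has a finite orbit outside its fixed
    points has a multiplier of finite order, and is not parabolic in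
    characteristic zero. *)
Lemma braid_support c y : phi c != 0 -> phi y != 0 -> c != b ->
  torsion (c * y / b).
Proof.
move=> pc py cb; set e := c * y / b.
have [c0 y0] := (phi_supp pc, phi_supp py).
have e0 : e != 0 by rewrite !mulf_neq0 ?invr_eq0.
have cE : b * e / y = c by rewrite /e; field; rewrite b0 y0.
have g0 : phi (b * e / y) * phi y != 0 by rewrite cE mulf_neq0.
have y1 : y != 1 by apply: contraNneq py => ->; rewrite phi1.
have ye : y != e by apply: contraNneq cb => yE; rewrite -cE -yE mulfK.
pose u n := iter n (braid_map e) y.
have un0 n : u n != 0 by have [] := braid_iter n e0 g0.
have [i [j [ij uij]]] := braid_recurrent e0 g0.
have [e1|e1] := eqVneq e 1.
  exfalso.
  (* For e = 1 the map is a translation in the coordinate 1 / (u - 1). *)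
  have uE n : (y - 1) = (u n - 1) * (n%:R * (y - 1) + 1).
    elim: n => [|n IH]; first by rewrite mul0r add0r mulr1.
    rewrite /u /= -/(u n) /braid_map e1 -natr1.
    have -> : (1 + 1 - 1 / u n - 1) * ((n%:R + 1) * (y - 1) + 1) =
       ((u n - 1) * (n%:R * (y - 1) + 1) + (u n - 1) * (y - 1)) / u n.
      by field; exact: un0.
    by rewrite -IH; field; exact: un0.
  have ui : u i - 1 != 0.
    by apply: contraNneq y1 => ui; rewrite -subr_eq0 (uE i) ui mul0r.
  have y1' : y - 1 != 0 by rewrite subr_eq0.
  have : (u i - 1) * (i%:R * (y - 1) + 1) = (u i - 1) * (j%:R * (y - 1) + 1).
    by rewrite -uE [in RHS]/u uij -/(u j) -uE.
  move=> /(mulfI ui) /addIr /(mulIf y1') /esym/eqP.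
  rewrite -subr_eq0 -natrB ?(ltnW ij)//; move/pcharf0P: k0 => ->.
  by rewrite subn_eq0 leqNgt ij.
have une n : u n != e.
  elim: n => [//|n IH]; apply: contraNneq IH; rewrite /u /= -/(u n) /braid_map => h.
  have : e / u n = 1.
    have -> : e / u n = 1 + e - (1 + e - e / u n) by ring.
    by rewrite h addrK.
  by move/(congr1 (fun x => x * u n)); rewrite divfK// mul1r => ->.
(* For e <> 1 the map is multiplication by e in the coordinate (u - 1) / (u -
   e). *)
have uE n : (u n - 1) * (y - e) = e ^+ n * (y - 1) * (u n - e).
  elim: n => [|n IH]; first by rewrite expr0 mul1r mulrC.
  rewrite /u /= -/(u n) /braid_map.
  have -> : (1 + e - e / u n - 1) * (y - e) = e / u n * ((u n - 1) * (y - e)).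
    by field; exact: un0.
  by rewrite IH exprS; field; exact: un0.
exists (j - i)%N; rewrite subn_gt0; split=> //.
have ue' : u i - e != 0 by rewrite subr_eq0.
have y1' : y - 1 != 0 by rewrite subr_eq0.
have : e ^+ i * (y - 1) * (u i - e) = e ^+ j * (y - 1) * (u i - e).
  have uij' : u i = u j := uij.
  by rewrite -uE uij' -uE.
move=> /(mulIf ue') /(mulIf y1'); rewrite -{1}(subnKC (ltnW ij)) exprD => h.
by apply: (mulfI (expf_neq0 i e0)); rewrite -h mulr1.
Qed.

(** If c <> b is in the support, then the support consists of roots of unity by
    braid_support. For y in the support and e = cy/b, the points y and y' =
    braid_map e y are then roots of unity with 1 + e = y' + e/y. Fixed points
    being excluded, e = -1 for every y in the support; the choices y = b and y
    = c give c = -1 and b = -1. *)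
Theorem braid_singleton c : phi c != 0 -> c = b.
Proof.
move=> pc; apply/eqP; apply: contrapT => /negP cb; have c0 := phi_supp pc.
have tc : torsion c by have := braid_support pc phib cb; rewrite mulfK.
have tb : torsion b.
  have := torsionM (torsionM tc tc) (torsionV (braid_support pc pc cb)).
  by congr torsion; field; rewrite b0 c0.
have tS y : phi y != 0 -> torsion y.
  move=> py; have [->//|yb] := eqVneq y b.
  by have := braid_support py phib yb; rewrite mulfK.
have main y : phi y != 0 -> c * y / b = -1.
  move=> py; have y0 := phi_supp py; set e := c * y / b.
  have e0 : e != 0 by rewrite !mulf_neq0 ?invr_eq0.
  have cE : b * e / y = c by rewrite /e; field; rewrite b0 y0.
  have g0 : phi (b * e / y) * phi y != 0 by rewrite cE mulf_neq0.
  have py' : phi (braid_map e y) != 0.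
    by apply: contraNneq g0 => h; rewrite braid_mapE// h mulr0.
  have te : torsion e.
    by apply: torsionM; [exact: torsionM tc (tS _ py)|exact: torsionV].
  have [//|yE] : e = -1 \/ y = braid_map e y.
    by apply: (sum_roots_of_unity k0 te (tS _ py) (tS _ py')); rewrite /braid_map subrK.
  exfalso; have : (y - 1) * (y - e) = 0.
    have : y * y = braid_map e y * y by rewrite -yE.
    rewrite /braid_map mulrBl divfK// => yy.
    have -> : (y - 1) * (y - e) = y * y - ((1 + e) * y - e) by ring.
    by rewrite yy subrr.
  move/eqP; rewrite mulf_eq0 !subr_eq0 => /orP[/eqP y1|/eqP ye].
    by move: py; rewrite y1 phi1 eqxx.
  by move: cb; rewrite -cE -ye mulfK// eqxx.
have cm1 : c = -1 by have := main b phib; rewrite mulfK.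
have := main c pc; rewrite cm1 mulN1r opprK mul1r => bm1.
by move: cb; rewrite cm1 -[b]invrK bm1 invrN1 eqxx.
Qed.

End BraidRelation.

(** * Subalgebras with an element outside the translations *)

Section AffineGroupLaw.
Variable k : fieldType.
Local Notation G := (affine k).
Implicit Types (a c q s : k) (b d : kstar k).

Definition aff a b : G := (a, b).

(** The value 1 at c = 0 is arbitrary: the coefficient function defined with it
    below is set to 0 there. *)
Definition unit_of c : kstar k := insubd (1%g : kstar k) c.

Lemma unit_ofE c : c != 0 -> val (unit_of c) = c.
Proof. by move=> c0; rewrite /unit_of val_insubd c0. Qed.

Lemma unit_ofK b : unit_of (val b) = b.
Proof. exact: valKd. Qed.

Lemma kstar_mulgC b d : (b * d = d * b)%g.
Proof. by apply: val_inj; rewrite /= mulrC. Qed.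

Lemma aff_mul a b c d : (aff a b * aff c d)%g = aff (a + val b * c) (b * d)%g.
Proof. by []. Qed.

Lemma aff_inv a b : (aff a b)^-1%g = aff (- ((val b)^-1 * a)) b^-1%g.
Proof. by []. Qed.

Lemma aff_eta (x : G) : x = aff x.1 x.2.
Proof. by case: x. Qed.

Lemma affW (Q : G -> Prop) : (forall a b, Q (aff a b)) -> forall x, Q x.
Proof. by move=> h [a b]; exact: h. Qed.

Lemma affP a b c d : aff a b = aff c d <-> a = c /\ b = d.
Proof. by split=> [[-> ->]|[-> ->]]. Qed.

Lemma aff_conjV s d a b :
  ((aff s d)^-1 * aff a b * aff s d)%g = aff ((a - s + val b * s) / val d) b.
Proof.
rewrite aff_inv !aff_mul; apply/affP; split; last by rewrite kstar_mulgC mulVKg.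
by rewrite /= -mulrN -mulrDr -mulrA -mulrDr mulrC [- s + a]addrC.
Qed.

Lemma aff_conj s d a b :
  (aff s d * aff a b * (aff s d)^-1)%g = aff (s + val d * a - val b * s) b.
Proof.
rewrite aff_inv !aff_mul; apply/affP; split; last by rewrite kstar_mulgC mulKg.
by rewrite /= mulrN -[val d * val b]mulrC -mulrA mulVKf ?kstar_neq0.
Qed.

Lemma subgroup_translations : subgroup_set (@translations k).
Proof.
split=> // [x y x1 y1|x x1].
  by rewrite -[translations _]/((x.2 * y.2)%g = 1%g) x1 y1 mulg1.
by rewrite -[translations _]/((x.2^-1)%g = 1%g) x1 invg1.
Qed.

End AffineGroupLaw.

Section AffineInvariant.
Variables (R : realType) (k : countFieldType) (k0 : [pchar k] =i pred0).
Local Notation C := R[i].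
Local Notation G := (affine k).
Local Notation H := (l2 R G).
Local Notation delta := (@delta R G).
Variable M : set (H -> H).
Hypothesis Msub : von_neumann_subalgebra (group_vN [set: G]) M.
Hypothesis Minv : G_invariant M.
Local Notation V := (subalg_l2 M).
Local Notation cexp := (@cexp R G M).
Local Notation aff := (@aff k).
Implicit Types (a q : k) (d : kstar k) (s t : G).

Lemma dot_single (f g : H) x : (forall y, y != x -> f y = 0 \/ g y = 0) ->
  dot f g = f x * (g x)^*.
Proof.
move=> h; apply: dotP.
apply: (@has_sum1 R G (fun y => f y * (g y)^*)) => y /h [->|->].
  by rewrite mul0r.
by rewrite rmorph0 mulr0.
Qed.

Lemma natrS_neq0 n : n.+1%:R != 0 :> k.
Proof. by move/pcharf0P: k0 => ->. Qed.

Lemma natr_injk : injective (fun n => n%:R : k).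
Proof.
move=> i j; wlog ij : i j / (i <= j)%N => [hw ijE|/= ijE].
  by case: (leqP i j) => [/hw->//|/ltnW /hw -> //].
apply/eqP; rewrite eqn_leq ij /= -subn_eq0; move/pcharf0P: k0 => <-.
by rewrite natrB// ijE subrr.
Qed.

Section Homothety.
Variable b : kstar k.
Hypothesis b1 : b != 1%g.
Local Notation X := (cexp (aff 0 b)).

(** E(v_b) is invariant under conjugation by k^*, under which (a, d) with a <>
    0 has an infinite orbit. *)
Lemma cexp_homothety_support a d : a != 0 -> X (aff a d) = 0.
Proof.
move=> a0; pose e n := aff (n.+1%:R * a) d.
have einj : injective e.
  by move=> i j /affP [/(mulIf a0) /natr_injk [->]].
have e0 : e 0 = aff a d by apply/affP; split=> //; exact: mul1r.
have XE c : X = Ad (aff 0 c) X.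
  by rewrite (Ad_cexp Msub Minv) aff_conj mulr0 add0r mulr0 subr0.
rewrite -e0; apply: l2_const_eq0 => // n.
rewrite e0 [in RHS](XE (unit_of n.+1%:R^-1)) AdE aff_conjV; congr (l2_fun _ _).
apply/affP; split=> //.
by rewrite unit_ofE ?invr_eq0 ?natrS_neq0// invrK mulr0 addr0 subr0 mulrC.
Qed.

(** The coefficients phi of E(v_b) = sum_c phi(c) v_c, extended by phi(0) = 0
    so that the braid relation holds without side conditions on z. *)
Definition homothety_coef (c : k) : C :=
  if c == 0 then 0 else X (aff 0 (unit_of c)).
Local Notation phi := homothety_coef.

Lemma homothety_coefE c : c != 0 -> phi c = X (aff 0 (unit_of c)).
Proof. by rewrite /phi => /negPf ->. Qed.

Lemma cexp_homothetyE a d : X (aff a d) = if a == 0 then phi (val d) else 0.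
Proof.
case: eqVneq => [->|]; last exact: cexp_homothety_support.
by rewrite homothety_coefE ?kstar_neq0// unit_ofK.
Qed.

Lemma homothety_coef0 : phi 0 = 0.
Proof. by rewrite /phi eqxx. Qed.

Lemma homothety_coef1 : phi 1 = 0.
Proof.
rewrite homothety_coefE ?oner_neq0//.
have -> : unit_of 1 = 1%g :> kstar k by apply: val_inj; rewrite unit_ofE ?oner_neq0.
rewrite -[aff 0 1%g]/(1%g : G) -dot_delta cexpE dot_l2_proj.
rewrite (l2_proj_id (subalg_l2_delta1 Msub)) dot_delta deltaE.
case: eqP => // /affP [_ b1E]; by move: b1; rewrite -b1E eqxx.
Qed.

Lemma homothety_coef_neq0 : X != 0 -> phi (val b) != 0.
Proof.
move=> X0; rewrite homothety_coefE ?kstar_neq0// unit_ofK.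
rewrite -(dot_cexp _ (@cexp_mem R G M (aff 0 b))).
by apply: contra X0 => /eqP/dotxx_eq0/eqP.
Qed.

Lemma homothety_coef_bounded c : normc (phi c) <= l2norm X.
Proof.
rewrite /phi; case: ifP => _; last exact: normc_le_l2norm.
by rewrite [normc _]normc0 l2norm_ge0.
Qed.

Lemma homothety_coef_decay (u : nat -> k) :
  injective u -> (forall n, u n != 0) ->
  (fun n => normc (phi (u n))) @ \oo --> (0 : R).
Proof.
move=> uinj u0; rewrite (_ : (fun _ => _) = fun n => normc (X (aff 0 (unit_of (u n))))).
  apply: l2_decay => i j /affP [_ /(congr1 val)].
  by rewrite !unit_ofE//; exact: uinj.
by apply/funext => n; rewrite homothety_coefE.
Qed.

(** This is cexp_commute for the conjugate v of E(v_b) by the translation 1, at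
    the coefficient x. On each side the supports meet in at most one point, so
    that each convolution is a single product. *)
Lemma homothety_coef_braid c y : c != 0 -> y != 0 ->
  let z := 1 - c * (1 - y) / val b in
  phi c * phi y = phi z * phi (c * y / z).
Proof.
move=> c0 y0 z; have b0 : val b != 0 by exact: kstar_neq0.
have cy0 : c * y != 0 by rewrite mulf_neq0.
pose v := Ad (aff 1 1%g) X; pose x := aff (c - c * y) (unit_of (c * y)).
have vE a d : v (aff a d) = X (aff (a - 1 + val d) d).
  rewrite /v AdE aff_conjV; congr (l2_fun _ _); apply/affP; split=> //.
  by rewrite mulr1; exact: divr1.
have tE (f : H) a d : lreg x (flip f) (aff a d) =
    (f (aff (val d^-1%g * (c - c * y - a)) (d^-1 * unit_of (c * y))%g))^*.
  rewrite lregE flipE invgM invgK /x aff_inv aff_mul; congr (_^*); congr (l2_fun _ _).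
  by apply/affP; split=> //; rewrite /=; ring.
have valE d : val (d^-1 * unit_of (c * y))%g = c * y / val d.
  by rewrite /= -[kstar_val _]/(val _) unit_ofE// mulrC.
have Vv : V v by apply: subalg_l2_Ad => //; exact: cexp_mem.
have := cexp_commute Msub Minv (aff 0 b) x Vv.
rewrite (@dot_single _ _ (aff 0 (unit_of c))); last first.
  elim/affW => a d wE.
  have [a0|a0] := eqVneq a 0; last by left; exact: cexp_homothety_support.
  right; rewrite tE vE cexp_homothetyE valE a0 subr0.
  case: eqP => [h|_]; last exact: rmorph0.
  exfalso; move: wE; rewrite a0; apply/negP; rewrite negbK; apply/eqP/affP; split=> //.
  apply: val_inj; rewrite unit_ofE//.
  have key (D : k) : D != 0 -> D^-1 * (c - c * y) - 1 + c * y / D = 0 -> D = c.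
    move=> D0 hD; apply/eqP; rewrite -subr_eq0 -oppr_eq0.
    have -> : - (D - c) = D * (D^-1 * (c - c * y) - 1 + c * y / D) by field.
    by rewrite hD mulr0.
  exact: key (kstar_neq0 d) h.
have valV d : val (d^-1)%g = (val d)^-1 by [].
rewrite tE conjCK vE subr0 valE !cexp_homothetyE valV unit_ofE// eqxx.
have -> : c^-1 * (c - c * y) - 1 + c * y / c = 0 by field.
rewrite eqxx valE unit_ofE// (_ : c * y / c = y); last by field.
move=> ->.
have vbE a d : Ad (aff 0 b) v (aff a d) = X (aff (a / val b - 1 + val d) d).
  by rewrite AdE aff_conjV mulr0 addr0 subr0 vE.
have off a d : val d != z ->
    Ad (aff 0 b) v (aff a d) = 0 \/ lreg x (flip X) (aff a d) = 0.
  move=> dz; have [ac|ac] := eqVneq (c - c * y - a) 0.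
    left; rewrite vbE cexp_homothety_support//; apply: contra dz => /eqP h.
    have aE : a = c - c * y by apply/eqP; rewrite eq_sym -subr_eq0 ac.
    have key (A B D : k) : B != 0 -> A = c - c * y -> A / B - 1 + D = 0 ->
        D = 1 - c * (1 - y) / B.
      by move=> B0 -> hD; apply/eqP; rewrite -subr_eq0 -hD; apply/eqP; field.
    by apply/eqP; exact: key b0 aE h.
  right; rewrite tE cexp_homothety_support ?rmorph0// mulf_neq0// valV invr_eq0.
  exact: kstar_neq0.
have [zE|z0] := eqVneq z 0.
  have off0 w : Ad (aff 0 b) v w = 0 \/ lreg x (flip X) w = 0.
    by elim/affW: w => a d; apply: off; rewrite zE kstar_neq0.
  rewrite (@dot_single _ _ 1%g) => [|w _]; last exact: off0.
  rewrite zE homothety_coef0 mul0r.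
  by case: (off0 1%g) => ->; rewrite ?mul0r ?rmorph0 ?mulr0.
rewrite (@dot_single _ _ (aff (c - c * y) (unit_of z))); last first.
  elim/affW => a d wE; have [dz|] := eqVneq (val d) z; last exact: off.
  right; rewrite tE cexp_homothety_support ?rmorph0// valV.
  apply: mulf_neq0; first by rewrite invr_eq0 kstar_neq0.
  apply: contra wE => /eqP ac; apply/eqP/affP; split.
    by apply/eqP; rewrite eq_sym -subr_eq0 ac.
  by apply: val_inj; rewrite unit_ofE.
rewrite vbE tE conjCK subrr mulr0 !cexp_homothetyE eqxx valE !unit_ofE//.
have -> : (c - c * y) / val b - 1 + z = 0 by rewrite /z; field.
by rewrite eqxx.
Qed.

(** By braid_singleton E(v_b) is a nonzero multiple of v_b. *)
Lemma lreg_homothety : X != 0 -> M (lreg (aff 0 b)).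
Proof.
move=> X0; have vb0 : val b != 0 by exact: kstar_neq0.
have phib := homothety_coef_neq0 X0.
have sing := braid_singleton k0 vb0 homothety_coef0 homothety_coef1 phib
  homothety_coef_bounded homothety_coef_decay homothety_coef_braid.
have XE : X = phi (val b) *: delta (aff 0 b).
  apply: l2P; elim/affW => a d; rewrite l2_scaleE deltaE cexp_homothetyE.
  case: eqP => [->|a0]; last first.
    by case: eqP => [/affP []|]; rewrite ?mulr0.
  case: eqP => [/affP [_ ->]|h]; first by rewrite mulr1.
  rewrite mulr0; apply/eqP; apply: contrapT => /negP /sing dE.
  by apply: h; apply/affP; split=> //; exact: val_inj.
apply: subalg_lreg => //.
have -> : delta (aff 0 b) = (phi (val b))^-1 *: X by rewrite XE scalerA mulVf// scale1r.
by apply: perp_scale; exact: cexp_mem.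
Qed.

End Homothety.

Lemma subalg_lregV t : M (lreg t) -> M (lreg t^-1%g).
Proof.
move=> Mt; have [[_ Mstar _] _] := Msub; apply: (Mstar (lreg t)) => //.
  exact: lreg_bounded.
exact: lreg_adjoint.
Qed.

Lemma subalg_lregM s t : M (lreg s) -> M (lreg t) -> M (lreg (s * t)%g).
Proof.
move=> Ms Mt; rewrite (_ : lreg _ = lreg s \o lreg t); first exact: subalg_comp.
by apply/funext => f; rewrite lreg_mul.
Qed.

Lemma subalg_lreg1 : M (lreg 1%g).
Proof.
rewrite (_ : lreg _ = id); first exact: subalg_id.
by apply/funext => f; rewrite lreg_one.
Qed.

Lemma subalg_lregJ s t : M (lreg t) -> M (lreg (s * t * s^-1)%g).
Proof.
move=> Mt; rewrite (_ : lreg _ = conj_op s (lreg t)); first exact: subalg_conj.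
by apply/funext => f; rewrite !lreg_mul.
Qed.

(** The commutator of v_b with a translation by t is the translation by (1 - b)
    t. *)
Lemma lreg_translation b a : b != 1%g -> M (lreg (aff 0 b)) -> M (lreg (aff a 1%g)).
Proof.
move=> b1 Mb; have vb1 : 1 - val b != 0.
  by rewrite subr_eq0 eq_sym; apply: contra b1 => /eqP h; apply/eqP/val_inj.
have := subalg_lregM (subalg_lregJ (aff (a / (1 - val b)) 1%g) Mb) (subalg_lregV Mb).
rewrite aff_conj mulr0 addr0 aff_inv aff_mul !mulr0 oppr0 mulr0 addr0 mulgV.
by rewrite (_ : a / _ - _ = a)//; field.
Qed.

Definition homothety_group : set (kstar k) := [set c | M (lreg (aff 0 c))].

Lemma homothety_groupP : is_subgroup homothety_group.
Proof.
split; first by rewrite inE; exact: subalg_lreg1.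
move=> c d; rewrite !inE /homothety_group /= => Mc Md.
have := subalg_lregM Mc (subalg_lregV Md).
by rewrite aff_inv aff_mul mulr0 oppr0 mulr0 addr0.
Qed.

Lemma cexp_eq0_conj a (c : kstar k) :
  c != 1%g -> cexp (aff 0 c) = 0 -> cexp (aff a c) = 0.
Proof.
move=> c1 xi0; have vc1 : 1 - val c != 0.
  by rewrite subr_eq0 eq_sym; apply: contra c1 => /eqP h; apply/eqP/val_inj.
have := Ad_cexp Msub Minv (aff (a / (1 - val c)) 1%g) (aff 0 c).
rewrite xi0 aff_conj mulr0 addr0 (_ : a / _ - _ = a); last by field.
by move=> <-; apply: l2P => x; rewrite AdE.
Qed.

(** All translations lie in M. For c <> 1, either E(v_c) = 0, and then the
    coefficients of M vanish on the conjugates (a, c) of (0, c), or v_c is in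
    M. *)
Lemma subalg_semidirect b : b != 1%g -> cexp (aff 0 b) != 0 ->
  M = group_vN (semidirect homothety_group).
Proof.
move=> b1 /(lreg_homothety b1) Mb.
have gS : subgroup_set (semidirect homothety_group).
  have [U1 UB] := homothety_groupP; have UV := group_closedV homothety_groupP.
  have UM := group_closedM homothety_groupP.
  rewrite /semidirect; split=> /=; first by move: U1; rewrite inE.
    move=> x y Ux Uy; have := UM x.2 y.2; rewrite !inE; exact.
  move=> x Ux; have := UV x.2; rewrite !inE; exact.
apply/seteqP; split=> T.
  move=> MT; apply/group_vNP => //; split; first exact: subalg_req MT.
  elim/affW => a c Uc.
  have VT : V (T (delta 1%g)) by have /subalgP [] := MT.
  have c1 : c != 1%g.
    by apply: contra_notN Uc => /eqP ->; exact: subalg_lreg1.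
  have xi0 : cexp (aff 0 c) = 0.
    apply/eqP; apply: contra_notT Uc => h; exact: lreg_homothety.
  by rewrite -(dot_cexp (aff a c) VT) cexp_eq0_conj ?dot0r.
have hM : [set lreg x | x in semidirect homothety_group] `<=` M.
  move=> _ [x Ux <-]; rewrite (aff_eta x).
  have -> : aff x.1 x.2 = (aff x.1 1 * aff 0 x.2)%g.
    by rewrite aff_mul mulr0 addr0 mul1g.
  by apply: subalg_lregM => //; exact: lreg_translation Mb.
rewrite -[in X in _ -> X](subalg_bicommutant Msub).
by apply: commutantS; apply: commutantS.
Qed.

End AffineInvariant.

(** * Subalgebras of the translation algebra *)

Section PointwiseLimits.
Variables (R : realType) (G : groupType).
Local Notation H := (l2 R G).
Implicit Types (f g h : H) (s t x : G).

Lemma l2norm_eq f g : dot f f = dot g g -> l2norm f = l2norm g.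
Proof.
rewrite !dotxx => /complexI /eqP; rewrite eqrXn2 ?l2norm_ge0//; exact: eqP.
Qed.

Lemma l2norm_lreg t f : l2norm (lreg t f) = l2norm f.
Proof. by apply: l2norm_eq; rewrite dot_lreg lregK. Qed.

Lemma l2norm_rreg t f : l2norm (rreg t f) = l2norm f.
Proof. by apply: l2norm_eq; rewrite dot_rreg -rreg_mul mulVg rreg_one. Qed.

Lemma l2norm_flip f : l2norm (flip f) = l2norm f.
Proof. by apply: l2norm_eq; rewrite dot_flip. Qed.

Lemma l2norm_Ad t f : l2norm (Ad t f) = l2norm f.
Proof. by rewrite l2norm_lreg l2norm_rreg. Qed.

(** The sequence h n - l delta_x converges weakly to 0. *)
Lemma dot_concentrate f (h : nat -> H) (K : R) x (l : R[i]) :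
  (forall n, l2norm (h n) <= K) -> (forall n, h n x = l) ->
  (forall y, y != x -> (fun n => normc (h n y)) @ \oo --> (0 : R)) ->
  (fun n => normc (dot f (h n) - f x * l^*)) @ \oo --> (0 : R).
Proof.
move=> hK hx hy; pose u n := h n - l *: delta R x.
rewrite (_ : (fun n => normc _) = fun n => normc (dot f (u n))); last first.
  by apply/funext => n; rewrite /u dotBr dotZr dot_delta mulrC.
apply: (@weak_cvg _ _ u (K + normc l * l2norm (delta R x))) => [n|y].
  by rewrite (le_trans (l2normD _ _))// l2normN l2normZ lerD2r.
have [->|yx] := eqVneq y x.
  rewrite (_ : (fun _ => _) = fun=> 0); first exact: cvg_cst.
  apply/funext => n; rewrite /u l2_addE l2_oppE l2_scaleE hx deltaE eqxx mulr1 subrr.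
  exact: normc0.
rewrite (_ : (fun _ => _) = fun n => normc (h n y)); first exact: hy.
apply/funext => n; rewrite /u l2_addE l2_oppE l2_scaleE deltaE (negPf yx).
by rewrite mulr0 subr0.
Qed.

Lemma dot_concentrate_eq f (h h' : nat -> H) (K : R) x x' (l l' : R[i]) :
  (forall n, dot f (h n) = dot f (h' n)) ->
  (forall n, l2norm (h n) <= K) -> (forall n, h n x = l) ->
  (forall y, y != x -> (fun n => normc (h n y)) @ \oo --> (0 : R)) ->
  (forall n, l2norm (h' n) <= K) -> (forall n, h' n x' = l') ->
  (forall y, y != x' -> (fun n => normc (h' n y)) @ \oo --> (0 : R)) ->
  f x * l^* = f x' * l'^*.
Proof.
move=> hh hK hx hy hK' hx' hy'.
have c := dot_concentrate f hK hx hy; have c' := dot_concentrate f hK' hx' hy'.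
set A := f x * _ in c *; set B := f x' * _ in c' *.
apply/eqP; rewrite -subr_eq0; apply/eqP/eq0_normc/eqP.
rewrite eq_le normc_ge0 andbT.
have : (fun n => normc (dot f (h' n) - B) + normc (dot f (h n) - A)) @ \oo --> (0 : R).
  by rewrite -[X in _ --> X](addr0 (0 : R)); apply: cvgD; [exact: c'|exact: c].
move=> /cvgrPdist_lt cc.
rewrite leNgt; apply/negP => AB0.
have [N _ /(_ N (leqnn N)) /=] := cc _ AB0.
rewrite sub0r normrN ger0_norm ?addr_ge0 ?normc_ge0// ltNge => /negP; apply.
have -> : A - B = (dot f (h' N) - B) + - (dot f (h N) - A) by rewrite hh; ring.
by rewrite (le_trans (le_normcD _ _))// normcN.
Qed.

End PointwiseLimits.

Section TranslationInvariant.
Variables (R : realType) (k : countFieldType) (k0 : [pchar k] =i pred0).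
Local Notation C := R[i].
Local Notation G := (affine k).
Local Notation H := (l2 R G).
Local Notation delta := (@delta R G).
Variable M : set (H -> H).
Hypothesis Msub : von_neumann_subalgebra (group_vN [set: G]) M.
Hypothesis Minv : G_invariant M.
Local Notation V := (subalg_l2 M).
Local Notation cexp := (@cexp R G M).
Local Notation aff := (@aff k).
Local Notation tr q := (aff q 1%g).
Hypothesis no_homothety : forall b : kstar k, b != 1%g -> cexp (aff 0 b) = 0.
Implicit Types (a c p q r : k) (d : kstar k) (s t : G).

Lemma subalg_l2_translation v a d : V v -> d != 1%g -> v (aff a d) = 0.
Proof.
move=> Vv d1; rewrite -(dot_cexp _ Vv) (cexp_eq0_conj Msub Minv) ?dot0r//.
exact: no_homothety.
Qed.

(** By equivariance under k^* this one function describes all the E(u_q), see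
    cexp_translationE. *)
Definition translation_coef c : C := cexp (tr 1) (tr c).
Local Notation phi := translation_coef.

Lemma cexp_translation q : q != 0 -> cexp (tr q) = Ad (aff 0 (unit_of q)) (cexp (tr 1)).
Proof.
move=> q0; rewrite (Ad_cexp Msub Minv) aff_conj.
by rewrite [_ * 1]mulr1 [_ * 0]mulr0 subr0 add0r unit_ofE.
Qed.

Lemma cexp_translationE q r : q != 0 -> cexp (tr q) (tr r) = phi (r / q).
Proof.
move=> q0; rewrite cexp_translation// AdE aff_conjV /phi; congr (l2_fun _ _).
by apply/affP; split=> //; rewrite unit_ofE// mulr0 addr0 subr0.
Qed.

Lemma cexp_at1 (t : G) : t != 1%g -> cexp t 1%g = 0.
Proof.
move=> t1; rewrite -dot_delta cexpE dot_l2_proj.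
rewrite (l2_proj_id (subalg_l2_delta1 Msub)) dot_delta deltaE eq_sym.
by rewrite (negPf t1).
Qed.

Lemma tr_neq1 q : q != 0 -> tr q != 1%g.
Proof. by apply: contra => /eqP/affP [-> _]. Qed.

Lemma translation_coefV c : c != 0 -> phi c^-1 = (phi c)^*.
Proof.
move=> c0; have E0 : phi c^-1 = cexp (tr c) (tr 1).
  by rewrite cexp_translationE// [1 / c]mul1r.
have E1 := dot_cexp (tr 1) (@cexp_mem R G M (tr c)).
have E2 := dot_cexp (tr c) (@cexp_mem R G M (tr 1)).
rewrite E0; transitivity (dot (cexp (tr c)) (cexp (tr 1))); first exact: esym E1.
by transitivity ((dot (cexp (tr 1)) (cexp (tr c)))^*); [exact: dotC|exact: congr1 E2].
Qed.

Lemma translation_coef_decay (u : nat -> k) : injective u ->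
  (fun n => normc (phi (u n))) @ \oo --> (0 : R).
Proof. by move=> uinj; apply: l2_decay => i j /affP [/uinj]. Qed.

(** This is cexp_right with the first argument moved to cexp (tr 1) by a
    homothety, so that the vector paired with the varying ones is fixed. *)
Lemma cexp_translation_right p q r : p != 0 -> 
  dot (cexp (tr 1)) (Ad (aff 0 (unit_of p))^-1%g (rreg (tr q) (cexp (tr r)))) =
  dot (cexp (tr 1)) (Ad (aff 0 (unit_of p))^-1%g (lreg (tr r) (flip (cexp (tr q))))).
Proof.
move=> p0; rewrite -!dot_Ad -cexp_translation//.
by apply: cexp_right => //; exact: cexp_mem.
Qed.

(** Compare the coefficients of u_r in E(E(u_p) u_q) = E(u_p) E(u_q). Each side
    is a sum over c of phi(c) times phi or its conjugate at a point depending
    on c; all of these points tend to infinity except one on each side. *)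
Lemma translation_coef_mul a b : a != 0 -> b != 0 ->
  phi a * phi b = phi (a / b) * phi b.
Proof.
move=> a0 b0.
(* With q = a, this choice gives r = ap + bq with p, q and r nonzero, so that c
   = a stays in place on the right-hand side and c = a/b on the left. *)
pose p n : k := b * n.+1%:R; pose r n : k := a * b * n.+2%:R.
have nS := natrS_neq0 k0.
have nS2 n : 1 + n%:R + 1 != 0 :> k by rewrite [1 + _]addrC !natr1 nS.
have p0 n : p n != 0 by rewrite mulf_neq0.
have r0 n : r n != 0 by rewrite !mulf_neq0.
pose h n := Ad (aff 0 (unit_of (p n)))^-1%g (rreg (tr a) (cexp (tr (r n)))).
pose h' n := Ad (aff 0 (unit_of (p n)))^-1%g (lreg (tr (r n)) (flip (cexp (tr a)))).
have AdV n (f : H) c d :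
    Ad (aff 0 (unit_of (p n)))^-1%g f (aff c d) = f (aff (p n * c) d).
  rewrite AdE invgK aff_conj; congr (l2_fun _ _); apply/affP; split=> //.
  by rewrite mulr0 subr0 add0r unit_ofE.
have hE n c : h n (tr c) = phi ((p n * c + a) / r n).
  rewrite /h AdV rregE aff_mul mulg1 -cexp_translationE//; congr (l2_fun _ _).
  by apply/affP; split=> //; rewrite mul1r.
have h'E n c : h' n (tr c) = (phi ((r n - p n * c) / a))^*.
  rewrite /h' AdV lregE flipE -cexp_translationE//; congr (_^*); congr (l2_fun _ _).
  rewrite invgM invgK aff_inv aff_mul mulg1 invg1; apply/affP; split=> //.
  by rewrite invr1 !mul1r addrC.
have [K norm1] : exists K, forall q, q != 0 -> l2norm (cexp (tr q)) <= K.
  by exists (l2norm (cexp (tr 1))) => q q0; rewrite cexp_translation// l2norm_Ad.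
have := @dot_concentrate_eq R G (cexp (tr 1)) h h' K
  (tr (a / b)) (tr a) (phi b^-1) (phi b)^*.
rewrite -/(phi (a / b)) -/(phi a) conjCK => <-.
- by rewrite translation_coefV// conjCK.
- by move=> n; exact: cexp_translation_right.
- by move=> n; rewrite /h l2norm_Ad l2norm_rreg; exact: norm1 (r0 n).
- move=> n; rewrite hE; congr phi; rewrite /p /r -[n.+2%:R]natr1.
  by field; rewrite nS2 a0 b0.
- elim/affW => c d cd; have [dE|d1] := eqVneq d 1%g; last first.
    rewrite (_ : (fun _ => _) = fun=> 0); first exact: cvg_cst.
    apply/funext => n; rewrite AdV rregE aff_mul mulg1 subalg_l2_translation//.
      exact: normc0.
    exact: cexp_mem.
  rewrite dE (_ : (fun _ => _) = fun n => normc (phi ((p n * c + a) / r n)));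
    last first.
    by apply/funext => n; rewrite hE.
  apply: translation_coef_decay => i j.
  have E n : (p n * c + a) / r n = c / a + (a - b * c) / (a * b) / n.+2%:R.
    by rewrite /p /r -[n.+2%:R]natr1; field; rewrite nS2 a0 b0.
  rewrite !E => /addrI /mulfI h1.
  have : (i.+2%:R : k)^-1 = j.+2%:R^-1.
    apply: h1; rewrite mulf_neq0// ?invr_eq0 ?mulf_neq0// subr_eq0.
    apply: contra cd => /eqP aE; rewrite dE; apply/eqP/affP; split=> //.
    by rewrite aE; field.
  by move/invr_inj/(natr_injk k0) => [].
- by move=> n; rewrite /h' l2norm_Ad l2norm_lreg l2norm_flip; exact: norm1 a0.
- move=> n; rewrite h'E; congr (_^*); congr phi; rewrite /p /r -[n.+2%:R]natr1.
  by field.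
- elim/affW => c d cd; have [dE|d1] := eqVneq d 1%g; last first.
    rewrite (_ : (fun _ => _) = fun=> 0); first exact: cvg_cst.
    apply/funext => n; rewrite AdV lregE flipE invgM invgK aff_inv aff_mul mulg1.
    rewrite subalg_l2_translation ?rmorph0; first exact: normc0.
      exact: cexp_mem.
    by apply: contra d1; rewrite invg_eq1.
  rewrite dE (_ : (fun _ => _) = fun n => normc (phi ((r n - p n * c) / a)));
    last first.
    by apply/funext => n; rewrite h'E normc_conj.
  apply: translation_coef_decay => i j.
  have E n : (r n - p n * c) / a = b + b * (1 - c / a) * n.+1%:R.
    by rewrite /p /r -[n.+2%:R]natr1; field.
  rewrite !E => /addrI /mulfI h1.
  have : (i.+1%:R : k) = j.+1%:R.
    apply: h1; rewrite mulf_neq0// subr_eq0.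
    apply: contra cd => /eqP aE; rewrite dE; apply/eqP/affP; split=> //.
    by rewrite -[c](divfK a0) -aE mul1r.
  by move/(natr_injk k0) => [].
Qed.

Lemma translation_coef0 : phi 0 = 0.
Proof. exact: cexp_at1 (tr_neq1 (oner_neq0 k)). Qed.

Lemma translation_coef1 : dot (cexp (tr 1)) (cexp (tr 1)) = phi 1.
Proof. by rewrite dot_cexp//; exact: cexp_mem. Qed.

(** E(u_q) = 0 for q <> 0, so only the coefficient at 1 remains. *)
Lemma subalg_scalar : phi 1 = 0 -> M = @scalar_operators R G.
Proof.
move=> phi1; have xi1 : cexp (tr 1) = 0 by apply: dotxx_eq0; rewrite translation_coef1.
have Vsupp v x : V v -> x != 1%g -> v x = 0.
  move=> Vv; elim/affW: x => q d x1.
  have [dE|d1] := eqVneq d 1%g; last exact: subalg_l2_translation.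
  have q0 : q != 0 by apply: contra x1 => /eqP ->; rewrite dE.
  rewrite dE -(dot_cexp _ Vv) cexp_translation// xi1.
  have -> : Ad (aff 0 (unit_of q)) 0 = 0 :> H by apply: l2P => y; rewrite AdE.
  exact: dot0r.
apply/seteqP; split=> T.
  move=> /(subalgP Msub) [hT VT]; exists (T (delta 1%g) 1%g).
  apply: req_ext => //; first exact: req_scale.
  apply: l2P => x; rewrite l2_scaleE deltaE.
  case: eqP => [->|/eqP x1]; first by rewrite mulr1.
  by rewrite mulr0 Vsupp.
move=> [c ->]; apply/(subalgP Msub); split; first exact: req_scale.
by apply: perp_scale; exact: subalg_l2_delta1.
Qed.

Definition stabilizer : set (kstar k) := [set d | phi (val d) != 0].

Section NonScalar.
Hypothesis phi1 : phi 1 != 0.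

Lemma stabilizer_coef a d : stabilizer d -> a != 0 -> phi (a / val d) = phi a.
Proof.
move=> Fd a0; have := translation_coef_mul a0 (kstar_neq0 d).
by move=> /(mulIf Fd).
Qed.

Lemma stabilizer_val d : stabilizer d -> phi (val d) = phi 1.
Proof.
move=> Fd; rewrite -(stabilizer_coef Fd (kstar_neq0 d)); congr phi.
by apply: divff; exact: kstar_neq0.
Qed.

Lemma stabilizer_subgroup : is_subgroup stabilizer.
Proof.
split; first by rewrite inE.
move=> c d; rewrite !inE /stabilizer /= => Fc Fd.
by have := Fc; rewrite -(stabilizer_coef Fd (kstar_neq0 c)).
Qed.

(** phi takes the same nonzero value on the whole support. *)
Lemma stabilizer_finite : finite_set stabilizer.
Proof.
have p0 : 0 < normc (phi 1) ^+ 2.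
  rewrite exprn_gt0// lt_def normc_ge0 andbT.
  by apply: contra phi1 => /eqP/eq0_normc ->.
have [A HA] := l2norm_adherent (cexp (tr 1)) p0.
apply: (@sub_finite_set _ _ ((fun d => tr (val d)) @^-1` [set` A])); last first.
  apply: finite_preimage; last exact: finite_fset.
  by move=> c d _ _ /affP [/val_inj].
move=> d Fd /=; apply: contrapT => /negP dA.
have := sum_le_l2norm (cexp (tr 1)) (tr (val d) |` A)%fset.
rewrite big_fsetU1//= -/(phi (val d)) (stabilizer_val Fd).
by move: HA; set S := \sum_(x <- A) _; lra.
Qed.

Lemma cexp_stabilizer q d : stabilizer d -> cexp (tr (q * val d)) = cexp (tr q).
Proof.
move=> Fd; have [->|q0] := eqVneq q 0; first by rewrite mul0r.
have qd0 : q * val d != 0 by rewrite mulf_neq0// kstar_neq0.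
apply: l2P; elim/affW => r c; have [->|c1] := eqVneq c 1%g; last first.
  by rewrite (subalg_l2_translation r (@cexp_mem R G M (tr (q * val d))) c1)
    (subalg_l2_translation r (@cexp_mem R G M (tr q)) c1).
rewrite !cexp_translationE//; have [->|r0] := eqVneq r 0; first by rewrite !mul0r.
by rewrite invfM mulrA stabilizer_coef// mulf_neq0// invr_eq0.
Qed.

(** The elements of L2(M) are invariant because cexp (tr (q f)) = cexp (tr q).
    Conversely let w be the component orthogonal to L2(M) of an invariant f. It
    is invariant too, hence constant on the support of cexp (tr q), so that <w,
    cexp (tr q)> is the value of w at q; but this inner product is 0. *)
Lemma subalg_fixed : M = @fixed_subalgebra k R stabilizer.
Proof.
apply/seteqP; split=> T.
  move=> /(subalgP Msub) [hT VT]; split.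
    apply/group_vNP; first exact: (subgroup_translations k).
    split=> //; elim/affW => a d /= d1.
    by apply: subalg_l2_translation => //; apply/eqP.
  move=> q d Fd; rewrite /fourier_coef.
  rewrite -[(q, 1%g)]/(tr q) -[(_ * _, 1%g)]/(tr (q * val d)).
  by rewrite -!(dot_cexp _ VT) cexp_stabilizer.
move=> [/(group_vNP _ (subgroup_translations k)) [hT Tsupp] Tfix].
apply/(subalgP Msub); split=> //.
set f := T (delta 1%g); pose p := l2_proj M f; have Vp : V p by exact: l2_proj_mem.
have Ww : subalg_perp M (f - p) by exact: l2_proj_perp.
set w := f - p in Ww.
suff w0 : w = 0 by rewrite (_ : f = p) // -(subrK p f) -/w w0 add0r.
have wsupp a d : d != 1%g -> w (aff a d) = 0.
  move=> d1; rewrite /w l2_addE l2_oppE (subalg_l2_translation _ Vp)// subr0 Tsupp//=.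
  exact/eqP.
have wfix q d : stabilizer d -> w (tr (q * val d)) = w (tr q).
  move=> Fd; rewrite /w !(l2_addE, l2_oppE) -!(dot_cexp _ Vp) cexp_stabilizer//.
  by congr (_ - _); symmetry; exact: Tfix.
apply: l2P; elim/affW => q d; rewrite l2_zeroE.
have [->|d1] := eqVneq d 1%g; last exact: wsupp.
have [->|q0] := eqVneq q 0.
  rewrite -[aff 0 1%g]/(1%g : G) -dot_delta dotC.
  by rewrite (dot_subalg_perp (subalg_l2_delta1 Msub) Ww) rmorph0.
have xiq : dot (cexp (tr q)) (cexp (tr q)) = phi 1.
  by rewrite dot_cexp ?cexp_translationE ?divff//; exact: cexp_mem.
have : dot w (cexp (tr q)) = 0.
  by rewrite dotC (dot_subalg_perp (@cexp_mem R G M (tr q)) Ww) rmorph0.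
(* On the support of cexp (tr q), whose values there are phi 1, w is constant.
   *)
rewrite (@eq_dot _ _ _ _ ((w (tr q) / phi 1) *: cexp (tr q)) (cexp (tr q))).
  by rewrite dotZl xiq divfK.
elim/affW => r c; rewrite l2_scaleE.
have [->|c1] := eqVneq c 1%g; last first.
  rewrite (wsupp _ _ c1) (subalg_l2_translation r (@cexp_mem R G M (tr q)) c1).
  by rewrite mulr0 !mul0r.
rewrite cexp_translationE//.
have [h|h] := eqVneq (phi (r / q)) 0; first by rewrite h rmorph0 !mulr0.
have rq0 : r / q != 0 by apply: contraNneq h => ->; rewrite translation_coef0.
have Frq : stabilizer (unit_of (r / q)) by rewrite /stabilizer /= unit_ofE.
have phirq : phi (r / q) = phi 1 by rewrite -(stabilizer_val Frq) unit_ofE.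
rewrite phirq divfK//; congr (_ * _).
by rewrite -(wfix q _ Frq) unit_ofE// mulrC divfK.
Qed.

End NonScalar.

End TranslationInvariant.

(** * Invariance of the listed algebras *)

Section Converse.
Variables (R : realType) (k : countFieldType).
Local Notation G := (affine k).
Local Notation H := (l2 R G).
Local Notation delta := (@delta R G).
Local Notation aff := (@aff k).

(** An element of L(G) is determined by its image of delta_1. *)
Lemma scalar_group_vN : @scalar_operators R G = group_vN [set 1%g].
Proof.
have g1 : subgroup_set ([set 1%g] : set G).
  by split=> [//|x y -> ->|x ->]; rewrite /= ?mulg1 ?invg1.
apply/seteqP; split=> T.
  move=> [c ->]; apply/(group_vNP _ g1); split; first exact: req_scale.
  by move=> x x1; rewrite l2_scaleE deltaE; case: eqP => // _; rewrite mulr0.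
move=> /(group_vNP _ g1) [hT T1]; exists (T (delta 1%g) 1%g).
apply: req_ext => //; first exact: req_scale.
apply: l2P => x; rewrite l2_scaleE deltaE.
by case: eqP => [->|x1]; [rewrite mulr1|rewrite mulr0 T1].
Qed.

Lemma scalar_invariant :
  von_neumann_subalgebra (group_vN [set: G]) (@scalar_operators R G) /\
  G_invariant (@scalar_operators R G).
Proof.
rewrite scalar_group_vN; apply: normal_group_vN.
  by split=> [//|x y -> ->|x ->]; rewrite /= ?mulg1 ?invg1.
move=> t x /= h; apply: (mulgI t^-1%g); apply: (mulIg t).
by rewrite h mulg1 mulVg.
Qed.

Lemma semidirect_subgroup (U : set (kstar k)) :
  is_subgroup U -> subgroup_set (semidirect U).
Proof.
move=> hU; have [U1 _] := hU.
split; first by move: U1; rewrite inE.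
  by move=> x y Ux Uy; have := group_closedM hU; move/(_ x.2 y.2); rewrite !inE; apply.
by move=> x Ux; have := group_closedV hU; move/(_ x.2); rewrite !inE; apply.
Qed.

Lemma conj_snd (t x : G) : (t^-1 * x * t)%g.2 = x.2.
Proof.
rewrite -[LHS]/((t.2^-1 * x.2 * t.2)%g).
by rewrite kstar_mulgC mulVKg.
Qed.

Lemma semidirect_invariant (U : set (kstar k)) : is_subgroup U ->
  von_neumann_subalgebra (group_vN [set: G]) (@group_vN R G (semidirect U)) /\
  G_invariant (@group_vN R G (semidirect U)).
Proof.
move=> /semidirect_subgroup sU; apply: normal_group_vN => // t x.
by rewrite -[semidirect U _]/(U (t^-1 * x * t)%g.2) conj_snd.
Qed.

Lemma translations_invariant :
  von_neumann_subalgebra (group_vN [set: G]) (@group_vN R G (@translations k)) /\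
  G_invariant (@group_vN R G (@translations k)).
Proof.
apply: normal_group_vN; first exact: (subgroup_translations k).
by move=> t x; rewrite -[translations (_ * _)%g]/((t^-1 * x * t)%g.2 = 1%g) conj_snd.
Qed.

Lemma conj_op_fixE t (T : H -> H) : conj_op t T = T <-> lreg t \o T = T \o lreg t.
Proof.
split=> [h|h]; apply/funext => f.
  by rewrite /= -{2}h /conj_op /= lregK.
rewrite /conj_op /=; have /(congr1 (fun W => W (lreg t^-1%g f))) /= -> := h.
by rewrite lregVK.
Qed.

(** For T in L(k), invariance of the coefficients under f means that T is fixed
    by conjugation with (0, f). *)
Lemma fixed_subalgebra_commutant (F : set (kstar k)) :
  @fixed_subalgebra k R F = commutant (commutant (@lreg R G @` @translations k)
    `|` [set lreg (aff 0 d) | d in F]).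
Proof.
have gT := subgroup_translations k.
apply/seteqP; split=> T.
  move=> [LT Tfix]; have [hT Tsupp] := (group_vNP T gT).1 LT.
  split; first exact: req_bounded.
  move=> S [CS|[d Fd <-]]; first exact: (proj2 LT).
  apply/esym/conj_op_fixE/req_ext => //; first exact: req_conj_op.
  rewrite conj_op_delta//; apply: l2P; elim/affW => q c.
  rewrite AdE aff_conjV mulr0 addr0 subr0.
  have [->|c1] := eqVneq c 1%g; last first.
    by rewrite !Tsupp//; apply/eqP.
  have := Tfix (q / val d) d Fd; rewrite /fourier_coef divfK ?kstar_neq0//.
move=> [bT hT].
have LT : group_vN (@translations k) T by split=> // S CS; apply: hT; left.
have [rT _] := (group_vNP T gT).1 LT.
split=> // q d Fd; rewrite /fourier_coef.
have E : conj_op (aff 0 d) T = T.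
  by apply/conj_op_fixE/esym/hT; right; exists d.
have := congr1 (fun W : H -> H => W (delta 1%g) (aff (q * val d) 1%g)) E.
rewrite conj_op_delta// AdE aff_conjV mulr0 addr0 subr0 mulfK ?kstar_neq0//.
Qed.

Lemma fixed_invariant (F : set (kstar k)) : is_subgroup F ->
  von_neumann_subalgebra (group_vN [set: G]) (@fixed_subalgebra k R F) /\
  G_invariant (@fixed_subalgebra k R F).
Proof.
move=> hF; have FV := group_closedV hF; have gT := subgroup_translations k.
have [[vnL sL] invL] := translations_invariant.
split.
  split; last by move=> T [/sL].
  rewrite fixed_subalgebra_commutant; apply: von_neumann_commutant.
    by move=> T [[]//|[d _ <-]]; exact: lreg_bounded.
  move=> T [CT|[d Fd <-]].
    have [S bS TS] := adjoint_exists (proj1 CT).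
    exists S => //; left; apply: commutant_adjoint CT bS TS => _ [t tt <-].
    exists (lreg t^-1%g); last exact: lreg_adjoint.
    by exists t^-1%g => //; have [_ _] := gT; apply.
  exists (lreg (aff 0 d)^-1%g); last exact: lreg_adjoint.
  right; exists d^-1%g; first by have := FV d; rewrite !inE; apply.
  by rewrite aff_inv mulr0 oppr0.
apply: G_invariantP => t T [LT Tfix]; split.
  by rewrite -(invL t); exists T.
have [rT _] := (group_vNP T gT).1 LT.
elim/affW: t => s d q f Ff; rewrite /fourier_coef conj_op_delta//.
rewrite !AdE -[(q, 1%g)]/(aff q 1%g) -[(q * _, 1%g)]/(aff (q * val f) 1%g).
have E u : (u - s + val (1%g : kstar k) * s) / val d = u / val d.
  by congr (_ / _); rewrite [_ * s]mul1r subrK.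
by rewrite !aff_conjV !E mulrAC; exact: Tfix.
Qed.

End Converse.

Theorem theorem4p9 (R : realType) (k : countFieldType)
    (k0 : [pchar k] =i pred0)
    (M : set (l2 R (affine k) -> l2 R (affine k))) :
  (von_neumann_subalgebra (group_vN [set: affine k]) M /\ G_invariant M) <->
  [\/ M = @scalar_operators R (affine k),
      exists F : set (kstar k),
        [/\ is_subgroup F, finite_set F & M = @fixed_subalgebra k R F]
    | exists U : set (kstar k),
        is_subgroup U /\ M = group_vN (semidirect U)].
Proof.
split=> [[Msub Minv]|[->|[F [hF _ ->]]|[U [hU ->]]]]; last first.
- exact: semidirect_invariant.
- exact: fixed_invariant.
- exact: scalar_invariant.
have [[b [b1 xib]]|hb] :=
    pselect (exists b : kstar k, b != 1%g /\ cexp M (aff 0 b) != 0).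
  apply: Or33; exists (homothety_group M); split; first exact: homothety_groupP.
  exact: (subalg_semidirect k0 Msub Minv b1 xib).
have h0 (b : kstar k) : b != 1%g -> cexp M (aff 0 b) = 0.
  by move=> b1; apply/eqP; apply: contrapT => /negP xib; apply: hb; exists b.
have [phi1|phi1] := eqVneq (translation_coef M 1) 0.
  by apply: Or31; exact: subalg_scalar.
apply: Or32; exists (stabilizer M); split.
- exact: (stabilizer_subgroup k0 Msub Minv h0 phi1).
- exact: (stabilizer_finite k0 Msub Minv h0 phi1).
- exact: (subalg_fixed k0 Msub Minv h0 phi1).
Qed.
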